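(* Let $\lambda>0$, $R>0$, let $\mathbf{x}_0\in\mathbb{R}^2$, and let $(\rho_0,\theta_0)$ be the polar coordinates of $\mathbf{x}_0$ with respect to the origin. Suppose that $$\phi(\mathbf{x})=\sum_{l=-\infty}^{\infty}\left(a_l Q_l(\rho')+b_l K_l(\lambda\rho')\right)e^{il\theta'},$$ where $(\rho',\theta')$ are the polar coordinates of $\mathbf{x}$ with respect to the point $\mathbf{x}_0$, is a multipole expansion (with complex coefficients $a_l,b_l$) of the potential due to a charge density which is contained inside the disk of radius $R$ about $\mathbf{x}_0$. Then, for $\mathbf{x}$ outside the disk of radius $R+\rho_0$ about the origin, we have $$\phi(\mathbf{x})=\sum_{l=-\infty}^{\infty}\left(c_l Q_l(\rho)+d_l K_l(\lambda\rho)\right)e^{il\theta},$$ where $(\rho,\theta)$ are the polar coordinates of $\mathbf{x}$ with respect to the origin, and the coefficients are as follows. For $l=0$, $c_0=a_0$ and $$d_0=\sum_{m=-\infty}^{-1}(a_m+b_m)I_{-m}(\lambda\rho_0)e^{im\theta_0}+a_0P_0(\rho_0)+b_0I_0(\lambda\rho_0)+\sum_{m=1}^{\infty}(a_m+b_m)I_{-m}(\lambda\rho_0)e^{im\theta_0}.$$ For $l>0$, $$c_l=\sum_{m=0}^{l}a_m\left(\frac{\lambda\rho_0}{2}\right)^{l-m}\frac{e^{-i(l-m)\theta_0}}{(l-m)!}$$ and $$d_l=\sum_{m=-\infty}^{-1}(a_m+b_m)I_{l-m}(\lambda\rho_0)e^{-i(l-m)\theta_0}+\sum_{m=0}^{l}\left(a_mP_{l-m}(\rho_0)+b_mI_{l-m}(\lambda\rho_0)\right)e^{-i(l-m)\theta_0}+\sum_{m=l+1}^{\infty}(a_m+b_m)I_{l-m}(\lambda\rho_0)e^{-i(l-m)\theta_0}.$$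 For $l<0$, $$c_l=\sum_{m=l}^{0}a_m\left(\frac{\lambda\rho_0}{2}\right)^{|l-m|}\frac{e^{-i(l-m)\theta_0}}{|l-m|!}$$ and $$d_l=\sum_{m=-\infty}^{l-1}(a_m+b_m)I_{l-m}(\lambda\rho_0)e^{-i(l-m)\theta_0}+\sum_{m=l}^{0}\left(a_mP_{l-m}(\rho_0)+b_mI_{l-m}(\lambda\rho_0)\right)e^{-i(l-m)\theta_0}+\sum_{m=1}^{\infty}(a_m+b_m)I_{l-m}(\lambda\rho_0)e^{-i(l-m)\theta_0}.$$
   Context: $I_n$ and $K_n$ ($n\in\mathbb{Z}$) are the modified Bessel functions of the first and second kind, with $I_{-n}=I_n$ and $K_{-n}=K_n$. For $r>0$ define $$Q_n(r)=K_n(\lambda r)-\frac{2^{|n|-1}(|n|-1)!}{\lambda^{|n|}r^{|n|}}\quad(n\neq0),\qquad Q_0(r)=K_0(\lambda r)+\log r,$$ and for $r\ge 0$, $n\in\mathbb{Z}$, define $$P_n(r)=I_n(\lambda r)-\left(\frac{\lambda r}{2}\right)^{|n|}\frac{1}{|n|!}.$$ Note that the factor $\lambda$ is already included in the definitions of $Q_n$ and $P_n$. The convention $0^0=1$ is used. The polar coordinates $(\rho',\theta')$ of $\mathbf{x}$ with respect to $\mathbf{x}_0$ are defined by $\mathbf{x}-\mathbf{x}_0=\rho'(\cos\theta',\sin\theta')$, and those with respect to the origin by $\mathbf{x}=\rho(\cos\theta,\sin\theta)$. The modified biharmonic equation is $\Delta(\Delta-\lambda^2)u=0$ in two dimensions,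 with free-space Green's function $\mathcal{G}(\mathbf{x},\mathbf{y})=-\frac{1}{2\pi\lambda^2}\left(K_0(\lambda|\mathbf{x}-\mathbf{y}|)+\log|\mathbf{x}-\mathbf{y}|\right)$. The potential due to a charge density contained in a disk is a superposition, over source points $\mathbf{y}$ in that disk, of $\mathcal{G}(\mathbf{x},\mathbf{y})$ and its first- and second-order directional derivatives. A multipole expansion of this potential is a series of the displayed form that converges absolutely to the potential at every $\mathbf{x}$ outside the disk. *)

(* Defs.v *)
From HB Require Import structures.
From mathcomp Require Export all_boot all_order all_algebra.
From mathcomp Require Export all_classical all_reals all_analysis.
From mathcomp Require Export complex.
Export Order.TTheory GRing.Theory Num.Theory numFieldNormedType.Exports.

Set Implicit Arguments.
Unset Strict Implicit.
Unset Printing Implicit Defensive.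

Local Open Scope complex_scope.
Local Open Scope classical_set_scope.
Local Open Scope ring_scope.

Section ComplexValues.
Variable R : realType.
Implicit Types (f : int -> R[i]) (D : pred int).

(* e^{it} for real t *)
Definition cexpi (t : R) : R[i] := cos t +i* sin t.

(* Series indexed by the integers m with D m: absolute convergence, and the
   value as the limit of the partial sums over -N <= m <= N, taken on real and
   imaginary parts.  [csum] is only meaningful together with [csummable]. *)
Definition csummable D f : Prop :=
  summable [set m | D m] (fun m => (Normc.normc (f m))%:E).

Definition cpartial D f (N : nat) : R[i] :=
  \sum_(0 <= k < N.*2.+1 | D (k%:Z - N%:Z)) f (k%:Z - N%:Z).

Definition csum D f : R[i] :=
  limn (fun N => complex.Re (cpartial D f N))
    +i* limn (fun N => complex.Im (cpartial D f N)).

(* the finite sum of f m over p <= m <= q, for p <= q *)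
Definition zsum (p q : int) f : R[i] :=
  \sum_(0 <= k < `|q - p|%N.+1) f (p + k%:Z).

Definition cintegrable d (T : measurableType d)
    (mu : {measure set T -> \bar R}) (f : T -> R[i]) : Prop :=
  mu.-integrable setT (fun y => (complex.Re (f y))%:E) /\
  mu.-integrable setT (fun y => (complex.Im (f y))%:E).

Definition cintegral d (T : measurableType d)
    (mu : {measure set T -> \bar R}) (f : T -> R[i]) : R[i] :=
  (\int[mu]_y complex.Re (f y)) +i* (\int[mu]_y complex.Im (f y)).

End ComplexValues.

Section Bessel.
Variable R : realType.
Implicit Types (n : int) (x r lambda : R).

Definition cosh x : R := (expR x + expR (- x)) / 2.

(* I_n(x) = sum_k (x/2)^(2k+|n|) / (k! (k+|n|)!), so that I_{-n} = I_n *)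
Definition besselI n x : R :=
  limn (series (fun k : nat =>
    (x / 2) ^+ (k.*2 + `|n|)%N / (k`! * (k + `|n|)`!)%N%:R)).

(* K_n(x) = int_0^oo e^{-x cosh t} cosh(n t) dt; used for x > 0 only *)
Definition besselK n x : R :=
  \int[lebesgue_measure]_(t in `[0, +oo[)
     (expR (- (x * cosh t)) * cosh (n%:~R * t)).

Definition Qfun lambda n r : R :=
  if n == 0 then besselK 0 (lambda * r) + ln r
  else besselK n (lambda * r)
       - 2 ^+ (`|n|%N.-1) * (`|n|%N.-1)`!%:R
         / (lambda ^+ `|n|%N * r ^+ `|n|%N).

Definition Pfun lambda n r : R :=
  besselI n (lambda * r) - (lambda * r / 2) ^+ `|n|%N * (`|n|%N`!%:R)^-1.

End Bessel.

Section Plane.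
Variable R : realType.
Implicit Types (x y c : R * R).

(* the Euclidean norm; the library's norm on R * R is the sup norm *)
Definition enorm x : R := Num.sqrt (x.1 ^+ 2 + x.2 ^+ 2).

(* (rho, theta) are polar coordinates of x with respect to c; theta is only
   determined modulo 2 pi, and is arbitrary if x = c *)
Definition polar_coords x c (rho theta : R) : Prop :=
  0 <= rho /\ x - c = (rho * cos theta, rho * sin theta).

Definition disk c (rad : R) : set (R * R) := [set y | enorm (y - c) <= rad].

Definition green (lambda : R) x y : R :=
  - (2 * pi * lambda ^+ 2)^-1
  * (besselK 0 (lambda * enorm (x - y)) + ln (enorm (x - y))).

(* One layer of sources: at the point y, a source of complex strength
   [density y] with respect to [layer_measure], whose field is the directional
   derivative of the Green's function along the directions [v y],
   v in [directions]; no direction means a point charge.  Measures may have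
   atoms or live on curves, so discrete charges and layer potentials are
   covered.  A charge density is a finite superposition of layers. *)
Record layer := Layer {
  layer_measure : {measure set (R * R) -> \bar R};
  density : R * R -> R[i];
  directions : seq (R * R -> R * R);
  directions_le2 : (size directions <= 2)%N
}.

Definition charge_density := seq layer.

(* Derivatives are taken in the source variable y; derivatives in x differ by
   a sign (-1)^(number of directions), which the density can absorb. *)
Definition layer_field (lambda : R) (q : layer) x y : R[i] :=
  density q y *
  (foldr (fun (v : R * R) (g : R * R -> R) => 'D_v g) (green lambda x)
     [seq v y | v <- directions q] y)%:C.

Definition charge_contained (q : charge_density) (S : set (R * R)) : Prop :=
  forall k : 'I_(size q), layer_measure (tnth (in_tuple q) k) (~` S) = 0%E.

Definition potential_defined (lambda : R) (q : charge_density) x : Prop :=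
  forall k : 'I_(size q),
    cintegrable (layer_measure (tnth (in_tuple q) k))
                (layer_field lambda (tnth (in_tuple q) k) x).

Definition potential (lambda : R) (q : charge_density) x : R[i] :=
  \sum_(s <- q) cintegral (layer_measure s) (layer_field lambda s x).

(* phi agrees, outside the disk of radius rad about c, with the potential due
   to a charge density contained in that disk *)
Definition is_disk_potential (lambda : R) c (rad : R) (phi : R * R -> R[i]) :
    Prop :=
  exists q : charge_density, charge_contained q (disk c rad) /\
    forall x, rad < enorm (x - c) ->
      potential_defined lambda q x /\ phi x = potential lambda q x.

Definition multipole_term (lambda : R) (a b : int -> R[i]) (rho theta : R)
    (l : int) : R[i] :=
  (a l * (Qfun lambda l rho)%:C + b l * (besselK l (lambda * rho))%:C)
  * cexpi (l%:~R * theta).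

Definition is_multipole_sum (lambda : R) (a b : int -> R[i]) (rho theta : R)
    (s : R[i]) : Prop :=
  csummable xpredT (multipole_term lambda a b rho theta) /\
  s = csum xpredT (multipole_term lambda a b rho theta).

Definition is_multipole_expansion (lambda : R) c (rad : R)
    (a b : int -> R[i]) (phi : R * R -> R[i]) : Prop :=
  is_disk_potential lambda c rad phi /\
  forall x rho theta, polar_coords x c rho theta -> rad < rho ->
    is_multipole_sum lambda a b rho theta (phi x).

End Plane.

Section Translation.
Variables (R : realType) (lambda : R) (a b : int -> R[i]) (rho0 theta0 : R).
Implicit Types l m : int.

Definition trans_c_term l m : R[i] :=
  a m * ((lambda * rho0 / 2) ^+ `|l - m|%N)%:C
  * (cexpi (- ((l - m)%:~R * theta0)) / (`|l - m|%N`!)%:R).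

Definition trans_c l : R[i] :=
  if l == 0 then a 0
  else if 0 < l then zsum 0 l (trans_c_term l)
  else zsum l 0 (trans_c_term l).

Definition trans_d_outer l m : R[i] :=
  (a m + b m) * (besselI (l - m) (lambda * rho0))%:C
  * cexpi (- ((l - m)%:~R * theta0)).

Definition trans_d_inner l m : R[i] :=
  (a m * (Pfun lambda (l - m) rho0)%:C
   + b m * (besselI (l - m) (lambda * rho0))%:C)
  * cexpi (- ((l - m)%:~R * theta0)).

Definition trans_d0_outer m : R[i] :=
  (a m + b m) * (besselI (- m) (lambda * rho0))%:C * cexpi (m%:~R * theta0).

Definition trans_d l : R[i] :=
  if l == 0 then
    csum (fun m => m <= -1) trans_d0_outer
    + a 0 * (Pfun lambda 0 rho0)%:C
    + b 0 * (besselI 0 (lambda * rho0))%:C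
    + csum (fun m => 1 <= m) trans_d0_outer
  else if 0 < l then
    csum (fun m => m <= -1) (trans_d_outer l)
    + zsum 0 l (trans_d_inner l)
    + csum (fun m => l + 1 <= m) (trans_d_outer l)
  else
    csum (fun m => m <= l - 1) (trans_d_outer l)
    + zsum l 0 (trans_d_inner l)
    + csum (fun m => 1 <= m) (trans_d_outer l).

(* absolute convergence of the infinite series occurring in [trans_d l] *)
Definition trans_d_summable l : Prop :=
  if l == 0 then
    csummable (fun m => m <= -1) trans_d0_outer /\
    csummable (fun m => 1 <= m) trans_d0_outer
  else if 0 < l then
    csummable (fun m => m <= -1) (trans_d_outer l) /\
    csummable (fun m => l + 1 <= m) (trans_d_outer l)
  else
    csummable (fun m => m <= l - 1) (trans_d_outer l) /\
    csummable (fun m => 1 <= m) (trans_d_outer l).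

End Translation.

(* Main.v *)
Require Import Defs.
From mathcomp Require Import ring lra zify measurable_realfun gauss_integral.
Set Implicit Arguments.
Unset Strict Implicit.
Unset Printing Implicit Defensive.
Local Open Scope complex_scope.
Local Open Scope classical_set_scope.
Local Open Scope ring_scope.
Local Notation Re := complex.Re.
Local Notation Im := complex.Im.
Local Notation normc := Normc.normc.

(** Let [L_l] be what [Q_l] subtracts from [K_l (lambda r)], so that [L_0 = - ln]
and otherwise [L_l r] is a multiple of [r ^- |l|] ([laurent] below).  A term of
the given expansion is
[((a_l + b_l) K_l (lambda rho') - a_l L_l rho') e^{i l theta'}],
and since [P_n] is [I_n] without its leading monomial, the claimed coefficients
satisfy
[d_l + c_l = sum_m (a_m + b_m) I_{l-m} (lambda rho0) e^{-i (l-m) theta0}].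
The theorem is therefore the difference of two translations: of the [K_m] with
coefficients [a_m + b_m], and of the [L_m] with coefficients [a_m].

The first is Graf's addition theorem ([graf_has_sum]).  It comes from
[2 K_m x = int e^{m t - x cosh t} dt] over the line: replacing [x] by
[x - y e^{i psi}] multiplies the integrand by two exponentials; expanding both
and integrating term by term gives the products [I_d y * K_{m+d} x], while
rotating the contour evaluates the integral itself.  The second
([laurent_translate]) is the binomial series of [(1 - u) ^- m] for [m <> 0] and
the series of [ln |1 - u|] for [m = 0], with [u = (rho0 / rho) e^{i psi}].

Both must be summed over [m] and the sums over [l] and [m] exchanged.  When the
two centres and the field point are aligned all terms are nonnegative, so the
moduli in row [m] add up to the [m]-th function at distance [rho - rho0]
([graf_nnsum], [laurent_translate_abs]); the single logarithmic row converges
absolutely as well.  As [rho - rho0 > rad], absolute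
convergence reduces to that of [sum_m (a_m + b_m) K_m (lambda r)] and of
[sum_m a_m L_m r] for each [r > rad], whereas the hypothesis only controls their
difference.  They are separated ([separate_bessel]) by comparing two radii:
for [m <> 0], [r ^ |m| L_m r] does not depend on [r], so a combination of the two
expansions eliminates the [a_m], and [besselK_gap] bounds from below what
remains of the [K_m]. *)

(** * Unconditional sums of real families *)
Section NonnegativeSums.
Variables (R : realType).
Implicit Types (T U : choiceType).

(** Nonnegative families with a finite sum, stated as a relation so that no finiteness
    side condition accompanies the equations between sums. *)
Definition nnsum T (f : T -> R) (s : R) : Prop :=
  (forall t, 0 <= f t) /\ (\esum_(t in setT) (f t)%:E)%E = s%:E.

Lemma nnsum_ge0 T (f : T -> R) s : nnsum f s -> 0 <= s.
Proof.
move=> [f0 fs]; rewrite -lee_fin -fs; apply: esum_ge0 => t _.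
by rewrite lee_fin.
Qed.

Lemma nnsum_uniq T (f : T -> R) s s' : nnsum f s -> nnsum f s' -> s = s'.
Proof. by move=> [_ e1] [_ e2]; apply: EFin_inj; rewrite -e1 -e2. Qed.

Lemma nnsumD T (f g : T -> R) s t : nnsum f s -> nnsum g t ->
  nnsum (fun x => f x + g x) (s + t).
Proof.
move=> [f0 fs] [g0 gt]; split; first by move=> x; rewrite addr_ge0.
rewrite EFinD -fs -gt -esumD//; last 2 first.
- by move=> x _; rewrite lee_fin.
- by move=> x _; rewrite lee_fin.
Qed.

Lemma nnsum_le T (f g : T -> R) s : nnsum g s -> (forall t, 0 <= f t <= g t) ->
  exists s', nnsum f s'.
Proof.
move=> [g0 gs] fg.
have les : (\esum_(t in setT) (f t)%:E <= s%:E)%E.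
  by rewrite -gs; apply: le_esum => t _; rewrite lee_fin; case/andP: (fg t).
have f0 : (0 <= \esum_(t in setT) (f t)%:E)%E.
  by apply: esum_ge0 => t _; rewrite lee_fin; case/andP: (fg t).
have ffin : (\esum_(t in setT) (f t)%:E)%E \is a fin_num.
  by rewrite ge0_fin_numE// (le_lt_trans les)// ltry.
exists (fine (\esum_(t in setT) (f t)%:E)%E).
by split; [by move=> t; case/andP: (fg t)|rewrite fineK].
Qed.

Lemma nnsum_finite T (f : T -> R) : (forall t, 0 <= f t) ->
  (\esum_(t in setT) (f t)%:E < +oo)%E -> exists s, nnsum f s.
Proof.
move=> f0 ffin; exists (fine (\esum_(t in setT) (f t)%:E)%E); split=> //.
by rewrite fineK// ge0_fin_numE//; apply: esum_ge0 => t _; rewrite lee_fin.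
Qed.

Lemma nnsum_mul T (f : T -> R) s c : 0 <= c -> nnsum f s ->
  nnsum (fun x => c * f x) (c * s).
Proof.
move=> c0 [f0 fs]; split; first by move=> t; rewrite mulr_ge0.
rewrite EFinM -fs; move: c0; rewrite le_eqVlt => /orP[/eqP <-|c0].
  by rewrite mul0e; apply: esum1 => t _; rewrite mul0r.
apply/eqP; rewrite eq_le; apply/andP; split.
  apply: ge_ereal_sup => _ /= [X [finX _] <-].
  under eq_fsbigr do rewrite EFinM.
  rewrite -ge0_mule_fsumr; last by move=> t; rewrite lee_fin.
  by rewrite lee_pmul2l ?lte_fin//; apply: ereal_sup_ubound; exists X.
rewrite -lee_pdivlMl//; apply: ge_ereal_sup => _ /= [X [finX _] <-].
rewrite lee_pdivlMl// ge0_mule_fsumr; last by move=> t; rewrite lee_fin.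
apply: ereal_sup_ubound; exists X => //.
Qed.

(** Tonelli: sum the rows, then sum the row sums. *)
Lemma nnsum_pair T U (F : T -> U -> R) (A : T -> R) s :
  (forall t, nnsum (F t) (A t)) ->
  nnsum A s <-> nnsum (fun p : T * U => F p.1 p.2) s.
Proof.
move=> FA.
have eqe : (\esum_(t in setT) (A t)%:E =
    \esum_(p in [set: T * U]) (F p.1 p.2)%:E)%E.
  transitivity (\esum_(t in setT) \esum_(u in setT) (F t u)%:E)%E.
    by apply: eq_esum => t _; rewrite (FA t).2.
  rewrite (@esum_esum _ _ _ setT (fun=> setT) (fun t u => (F t u)%:E)).
    by congr esum; apply/seteqP; split.
  by move=> t u _ _; rewrite lee_fin (FA t).1.
split=> [[A0 As]|[F0 Fs]]; split.
- by move=> p; exact: (FA p.1).1.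
- by rewrite -eqe.
- by move=> t; exact: nnsum_ge0 (FA t).
- by rewrite eqe.
Qed.

Lemma nnsum_section T U (F : T * U -> R) s t : nnsum F s ->
  exists s', nnsum (fun u => F (t, u)) s'.
Proof.
move=> [F0 Fs]; apply: nnsum_finite => //.
have inj : set_inj [set: U] (pair t : U -> T * U) by move=> u v _ _ [].
have := @esum_image R _ _ [set: U] (pair t) (fun p : T * U => (F p)%:E) inj.
move=> /= <-.
apply: (@le_lt_trans _ _ (\esum_(p in [set: T * U]) (F p)%:E)%E); last first.
  by rewrite Fs ltry.
rewrite [leLHS]esum_mkcond; apply: le_esum => p _.
by case: ifP => _; rewrite lee_fin.
Qed.

Lemma nnsum_reindex T U (e : T -> U) (f : U -> R) s : bijective e ->
  nnsum f s -> nnsum (f \o e) s.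
Proof.
move=> [e' ee' e'e] [f0 fs]; split; first by move=> t /=.
rewrite -fs; apply/esym/reindex_esum; split => //.
- by move=> x y _ _ exy; rewrite -(ee' x) exy ee'.
- by move=> u _; exists (e' u).
Qed.

Lemma nnsum_term_le T (f : T -> R) s t : nnsum f s -> f t <= s.
Proof.
move=> [f0 fs]; rewrite -lee_fin -fs; apply: ereal_sup_ubound.
by exists [set t]; [split=> //|rewrite fsbig_set1].
Qed.

Lemma nnsum_bounded (f : nat -> R) (B : R) : (forall n, 0 <= f n) ->
  (forall n, series f n <= B) -> exists s, nnsum f s.
Proof.
move=> f0 fB.
have le : (\esum_(t in setT) (f t)%:E <= B%:E)%E.
  rewrite -nneseries_esumT; last by move=> n; rewrite lee_fin.
  apply: lime_le; first by apply: is_cvg_nneseries => n _ _; rewrite lee_fin.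
  by apply: nearW => n; rewrite sumEFin lee_fin; exact: fB.
by apply: nnsum_finite => //; rewrite (le_lt_trans le)// ltry.
Qed.

Lemma nnsum_series (f : nat -> R) s : nnsum f s -> series f @ \oo --> s.
Proof.
move=> [f0 fs].
have : (fun n => (\sum_(0 <= k < n) (f k)%:E)%E) @ \oo --> s%:E.
  rewrite -fs -nneseries_esumT; last by move=> n; rewrite lee_fin.
  by apply: is_cvg_nneseries => n _ _; rewrite lee_fin.
under eq_fun do rewrite sumEFin.
by move/fine_cvgP => [_].
Qed.

Lemma nnsum_cvg (f : nat -> R) s : (forall n, 0 <= f n) -> series f @ \oo --> s -> nnsum f s.
Proof.
move=> f0 fs.
have [s' fs'] : exists s', nnsum f s'.
  apply: (@nnsum_bounded _ s) => // n.
  rewrite -(cvg_lim (@norm_hausdorff _ _) fs); apply: nondecreasing_cvgn_le.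
    by apply: nondecreasing_series => k _ _; exact: f0.
  by apply/cvg_ex; exists s.
by rewrite (cvg_unique (@norm_hausdorff _ _) fs (nnsum_series fs')).
Qed.

(** Splitting the integers into the two constructors turns the symmetric
    partial sums into two ordinary series. *)
Lemma sum_symmetric_int (V : zmodType) (f : int -> V) N :
  \sum_(0 <= k < N.*2.+1) f (k%:Z - N%:Z) =
  series (f \o Posz) N.+1 + series (f \o Negz) N.
Proof.
elim: N => [|N IH].
  by rewrite /series/= !big_mkord !big_ord_recl !big_ord0 /= !addr0.
rewrite doubleS big_nat_recl//= big_nat_recr//=.
have shiftE (k : nat) : k.+1%:Z - N.+1%:Z = k%:Z - N%:Z by lia.
under eq_bigr do rewrite shiftE.
rewrite shiftE.
rewrite IH /series/= [in RHS]big_nat_recr//= [X in _ = _ + X]big_nat_recr//=.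
have -> : 0%:Z - N.+1%:Z = Negz N by lia.
have -> : (N.*2.+1)%:Z - N%:Z = N.+1%:Z by lia.
by rewrite [LHS]addrC -!addrA; congr (_ + _); rewrite addrCA.
Qed.

Lemma esum_int (f : int -> R) : (forall m, 0 <= f m) ->
  (\esum_(m in [set: int]) (f m)%:E = \esum_(n in [set: nat]) ((f \o Posz) n)%:E +
    \esum_(n in [set: nat]) ((f \o Negz) n)%:E)%E.
Proof.
move=> f0.
have bij1 : set_bij [set: nat] [set m : int | 0 <= m] Posz.
  split=> [n _ //|m n _ _ [] //|[n _|n //]]; by exists n.
have bij2 : set_bij [set: nat] (~` [set m : int | 0 <= m]) Negz.
  split=> [n _ //|m n _ _ [] //|[n []//|n _]]; by exists n.
rewrite (esumID [set m : int | 0 <= m]); last by move=> t _; rewrite lee_fin.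
rewrite !setTI (reindex_esum _ _ _ (fun m => (f m)%:E) bij1).
by rewrite (reindex_esum _ _ _ (fun m => (f m)%:E) bij2).
Qed.

Lemma nnsum_int_split (f : int -> R) p q :
  nnsum (f \o Posz) p -> nnsum (f \o Negz) q -> nnsum f (p + q).
Proof.
move=> [f0 fp] [f0' fq].
have fge0 m : 0 <= f m by case: m => n; [exact: f0|exact: f0'].
by split; rewrite // esum_int// fp fq.
Qed.

Lemma nnsum_int (f : int -> R) s : nnsum f s ->
  (fun N => \sum_(0 <= k < N.*2.+1) f (k%:Z - N%:Z)) @ \oo --> s.
Proof.
move=> fs; have [f0 fse] := fs; have eE := esum_int f0.
have ge0 (e : nat -> int) : (0 <= \esum_(n in [set: nat]) ((f \o e) n)%:E)%E.
  by apply: esum_ge0 => n _; rewrite lee_fin; exact: f0.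
have lts : (\esum_(m in [set: int]) (f m)%:E < +oo)%E by rewrite fse ltry.
have [p fp] : exists p, nnsum (f \o Posz) p.
  apply: nnsum_finite => [t|]; first exact: f0.
  by apply: le_lt_trans lts; rewrite eE leeDl// ge0.
have [q fq] : exists q, nnsum (f \o Negz) q.
  apply: nnsum_finite => [t|]; first exact: f0.
  by apply: le_lt_trans lts; rewrite eE leeDr// ge0.
have -> : s = p + q := nnsum_uniq fs (nnsum_int_split fp fq).
under eq_fun do rewrite sum_symmetric_int.
apply: cvgD; last exact: nnsum_series.
by have := nnsum_series fp; rewrite -cvg_shiftS.
Qed.

End NonnegativeSums.

Section RealSums.
Variable R : realType.
Implicit Types (T U : choiceType).

(** A decomposition into two nonnegative families is asked for, not the one into
    positive and negative parts: any decomposition gives the same value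
    ([rhas_sum_uniq]), and sums, products with scalars and rows of a double
    family then inherit one without computing positive parts. *)
Definition rhas_sum T (f : T -> R) (s : R) : Prop :=
  exists g h p q, [/\ nnsum g p, nnsum h q, forall t, f t = g t - h t & s = p - q].

Lemma nnsum_rhas_sum T (f : T -> R) s : nnsum f s -> rhas_sum f s.
Proof.
move=> fs; exists f, (fun=> 0), s, 0; split => //; last 2 first.
- by move=> t; rewrite subr0.
- by rewrite subr0.
by split=> //; apply: esum1.
Qed.

(** Two decompositions [g - h = g' - h'] are compared through [g + h' = g' + h],
    an equality between nonnegative families. *)
Lemma rhas_sum_uniq T (f : T -> R) s s' : rhas_sum f s -> rhas_sum f s' -> s = s'.
Proof.
move=> [g [h [p [q [gp hq fE ->]]]]] [g' [h' [p' [q' [gp' hq' fE' ->]]]]].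
have e1 := nnsumD gp hq'; have e2 := nnsumD gp' hq.
suff : p + q' = p' + q by lra.
apply: nnsum_uniq e1 _.
rewrite (_ : (fun _ => _) = (fun t => g' t + h t))//; apply/funext => t.
by have := fE t; rewrite (fE' t); lra.
Qed.

Lemma rhas_sum_nnsum T (f : T -> R) s : (forall t, 0 <= f t) ->
  rhas_sum f s -> nnsum f s.
Proof.
move=> f0 fs; have [g [h [p [q [gp hq fE sE]]]]] := fs.
have [|s' fs'] := nnsum_le (f := f) gp.
  by move=> t; rewrite f0/= fE gerBl hq.1.
by rewrite (rhas_sum_uniq fs (nnsum_rhas_sum fs')).
Qed.

Lemma rhas_sum_abs T (f : T -> R) s : rhas_sum f s ->
  exists s', nnsum (fun t => `|f t|) s'.
Proof.
move=> [g [h [p [q [gp hq fE _]]]]].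
have [|s' fs'] := nnsum_le (f := fun t => `|f t|) (nnsumD gp hq).
  move=> t; rewrite normr_ge0/= fE (le_trans (ler_normB _ _))//.
  by rewrite !ger0_norm ?gp.1 ?hq.1.
by exists s'.
Qed.

Lemma rhas_sum_exists T (f : T -> R) s : nnsum (fun t => `|f t|) s ->
  exists s', rhas_sum f s'.
Proof.
move=> fs.
have [|p gp] := nnsum_le (f := fun t => Num.max (f t) 0) fs.
  move=> t; rewrite le_max lexx orbT/= ge_max normr_ge0 andbT; exact: ler_norm.
have [|q hq] := nnsum_le (f := fun t => Num.max (- f t) 0) fs.
  move=> t; rewrite le_max lexx orbT/= ge_max normr_ge0 andbT -normrN; exact: ler_norm.
exists (p - q), (fun t => Num.max (f t) 0), (fun t => Num.max (- f t) 0), p, q; split=> // t.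
by rewrite /Num.max; case: ifP; case: ifP; lra.
Qed.

Lemma rhas_sumD T (f g : T -> R) s t : rhas_sum f s -> rhas_sum g t ->
  rhas_sum (fun x => f x + g x) (s + t).
Proof.
move=> [g1 [h1 [p1 [q1 [gp1 hq1 fE1 ->]]]]] [g2 [h2 [p2 [q2 [gp2 hq2 fE2 ->]]]]].
exists (fun x => g1 x + g2 x), (fun x => h1 x + h2 x), (p1 + p2), (q1 + q2).
split; [exact: nnsumD|exact: nnsumD|by move=> x; rewrite fE1 fE2; ring|by ring].
Qed.

Lemma rhas_sumN T (f : T -> R) s : rhas_sum f s -> rhas_sum (fun x => - f x) (- s).
Proof.
move=> [g [h [p [q [gp hq fE ->]]]]]; exists h, g, q, p; split => //.
- by move=> t; rewrite fE opprB.
- by rewrite opprB.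
Qed.

Lemma rhas_sumM T (f : T -> R) s c : rhas_sum f s -> rhas_sum (fun x => c * f x) (c * s).
Proof.
wlog c0 : c / 0 <= c.
  move=> H fs; have [c0|c0] := leP 0 c; first exact: H.
  have := rhas_sumN (H (- c) _ fs); rewrite -mulNr opprK; under eq_fun do rewrite -mulNr opprK.
  by apply; lra.
move=> [g [h [p [q [gp hq fE ->]]]]].
exists (fun x => c * g x), (fun x => c * h x), (c * p), (c * q); split.
- exact: nnsum_mul.
- exact: nnsum_mul.
- by move=> t; rewrite fE mulrBr.
- by rewrite mulrBr.
Qed.

(** Fubini: each row inherits a decomposition from that of the whole family. *)
Lemma rhas_sum_pair T U (F : T * U -> R) (A : T -> R) s :
  rhas_sum F s -> (forall t, rhas_sum (fun u => F (t, u)) (A t)) -> rhas_sum A s.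
Proof.
move=> [g [h [p [q [gp hq FE ->]]]]] FA.
have /choice[P gP] := fun t => nnsum_section t gp.
have /choice[Q hQ] := fun t => nnsum_section t hq.
exists P, Q, p, q; split=> //.
- by apply/(nnsum_pair p gP); rewrite (_ : (fun _ => _) = g)//; apply/funext => -[].
- by apply/(nnsum_pair q hQ); rewrite (_ : (fun _ => _) = h)//; apply/funext => -[].
- move=> t; apply: rhas_sum_uniq (FA t) _.
  by exists (fun u => g (t, u)), (fun u => h (t, u)), (P t), (Q t); split.
Qed.

Lemma rhas_sum_reindex T U (e : T -> U) (f : U -> R) s : bijective e ->
  rhas_sum f s -> rhas_sum (f \o e) s.
Proof.
move=> be [g [h [p [q [gp hq fE ->]]]]].
exists (g \o e), (h \o e), p, q; split=> //.
- exact: nnsum_reindex.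
- exact: nnsum_reindex.
- by move=> t /=.
Qed.

Lemma rhas_sum_series (f : nat -> R) s : rhas_sum f s -> series f @ \oo --> s.
Proof.
move=> [g [h [p [q [gp hq fE ->]]]]].
rewrite (_ : series f = series g \- series h); last first.
  by apply/funext => n; rewrite /series /= -sumrB; apply: eq_bigr => k _.
by apply: cvgB; exact: nnsum_series.
Qed.

Lemma rhas_sum_int (f : int -> R) s : rhas_sum f s ->
  (fun N => \sum_(0 <= k < N.*2.+1) f (k%:Z - N%:Z)) @ \oo --> s.
Proof.
move=> [g [h [p [q [gp hq fE ->]]]]].
rewrite (_ : (fun _ => _) = (fun N => \sum_(0 <= k < N.*2.+1) g (k%:Z - N%:Z))
   \- (fun N => \sum_(0 <= k < N.*2.+1) h (k%:Z - N%:Z))); last first.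
  by apply/funext => n; rewrite /= -sumrB; apply: eq_bigr => k _.
by apply: cvgB; exact: nnsum_int.
Qed.

End RealSums.

(** * Unconditional sums of complex families *)
Section ComplexSums.
Variable R : realType.
Implicit Types (T U : choiceType) (z w : R[i]).

Lemma normc_ge0 z : 0 <= normc z.
Proof. by case: z => x y; rewrite /normc sqrtr_ge0. Qed.

Lemma ReD z w : Re (z + w) = Re z + Re w. Proof. by case: z; case: w. Qed.
Lemma ImD z w : Im (z + w) = Im z + Im w. Proof. by case: z; case: w. Qed.
Lemma ReN z : Re (- z) = - Re z. Proof. by case: z. Qed.
Lemma ImN z : Im (- z) = - Im z. Proof. by case: z. Qed.
Lemma ReM z w : Re (z * w) = Re z * Re w - Im z * Im w.
Proof. by case: z; case: w. Qed.
Lemma ImM z w : Im (z * w) = Re z * Im w + Im z * Re w.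
Proof. by case: z => a b; case: w => c d; rewrite /= addrC. Qed.

Lemma complex_eq z w : Re z = Re w -> Im z = Im w -> z = w.
Proof. by case: z; case: w => a b c d /= -> ->. Qed.

Lemma Re_le_normc z : `|Re z| <= normc z.
Proof.
case: z => x y /=; rewrite -sqrtr_sqr ler_wsqrtr// lerDl; exact: sqr_ge0.
Qed.

Lemma Im_le_normc z : `|Im z| <= normc z.
Proof.
case: z => x y /=; rewrite -sqrtr_sqr ler_wsqrtr// lerDr; exact: sqr_ge0.
Qed.

Lemma normc_le z : normc z <= `|Re z| + `|Im z|.
Proof.
case: z => x y /=.
rewrite -[leRHS]ger0_norm ?addr_ge0// -sqrtr_sqr ler_wsqrtr//.
rewrite -[x ^+ 2]real_normK ?num_real// -[y ^+ 2]real_normK ?num_real//.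
have := normr_ge0 x; have := normr_ge0 y; nra.
Qed.

Lemma normc_real (x : R) : normc x%:C = `|x|.
Proof. by rewrite /= expr0n addr0 sqrtr_sqr. Qed.

Lemma normc_cexpi (t : R) : normc (cexpi t) = 1.
Proof. by rewrite /= cos2Dsin2 sqrtr1. Qed.

Lemma natC (n : nat) : (n%:R : R[i]) = (n%:R)%:C.
Proof. by rewrite rmorph_nat. Qed.

Lemma normcX z n : normc (z ^+ n) = normc z ^+ n.
Proof.
elim: n => [|n IH]; first by rewrite !expr0 Normc.normc1.
by rewrite !exprS Normc.normcM IH.
Qed.

Lemma cexpiD (s t : R) : cexpi (s + t) = cexpi s * cexpi t.
Proof. by apply: complex_eq; rewrite ?ReM ?ImM /= ?cosD ?sinD; ring. Qed.

Lemma cexpi0 : cexpi (0 : R) = 1.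
Proof. by apply: complex_eq; rewrite /= ?cos0 ?sin0. Qed.

Lemma cexpiMn (t : R) n : cexpi (n%:R * t) = cexpi t ^+ n.
Proof.
elim: n => [|n IH]; first by rewrite mul0r cexpi0.
by rewrite exprS -IH -cexpiD -natr1; congr cexpi; ring.
Qed.

Definition has_sum T (f : T -> R[i]) (s : R[i]) : Prop :=
  rhas_sum (fun t => Re (f t)) (Re s) /\ rhas_sum (fun t => Im (f t)) (Im s).

Lemma has_sum_uniq T (f : T -> R[i]) s s' : has_sum f s -> has_sum f s' -> s = s'.
Proof.
by move=> [? ?] [? ?]; apply: complex_eq; apply: rhas_sum_uniq; eassumption.
Qed.

Lemma eq_has_sum T (f g : T -> R[i]) s : f =1 g -> has_sum f s -> has_sum g s.
Proof. by move=> /funext ->. Qed.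

Lemma has_sumD T (f g : T -> R[i]) s t : has_sum f s -> has_sum g t ->
  has_sum (fun x => f x + g x) (s + t).
Proof.
move=> [f1 f2] [g1 g2]; split; rewrite ?ReD ?ImD.
- by under eq_fun do rewrite ReD; exact: rhas_sumD.
- by under eq_fun do rewrite ImD; exact: rhas_sumD.
Qed.

Lemma has_sumN T (f : T -> R[i]) s : has_sum f s -> has_sum (fun x => - f x) (- s).
Proof.
move=> [f1 f2]; split; rewrite ?ReN ?ImN.
- by under eq_fun do rewrite ReN; exact: rhas_sumN.
- by under eq_fun do rewrite ImN; exact: rhas_sumN.
Qed.

Lemma has_sumB T (f g : T -> R[i]) s t : has_sum f s -> has_sum g t ->
  has_sum (fun x => f x - g x) (s - t).
Proof. by move=> fs gt; apply: has_sumD => //; exact: has_sumN. Qed.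

Lemma has_sumM T (f : T -> R[i]) s c : has_sum f s ->
  has_sum (fun x => c * f x) (c * s).
Proof.
move=> [f1 f2]; split; rewrite ?ReM ?ImM.
- under eq_fun do rewrite ReM.
  by apply: rhas_sumD; [exact: rhas_sumM|apply: rhas_sumN; exact: rhas_sumM].
- under eq_fun do rewrite ImM.
  by apply: rhas_sumD; exact: rhas_sumM.
Qed.

Lemma has_sum_real T (f : T -> R) s : rhas_sum f s ->
  has_sum (fun t => (f t)%:C) s%:C.
Proof.
by move=> fs; split => //=; apply: nnsum_rhas_sum; split=> //; exact: esum1.
Qed.

Lemma has_sum_abs T (f : T -> R[i]) s : has_sum f s ->
  exists s', nnsum (fun t => normc (f t)) s'.
Proof.
move=> [f1 f2].
have [p fp] := rhas_sum_abs f1; have [q fq] := rhas_sum_abs f2.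
have [|s' fs'] := nnsum_le (f := fun t => normc (f t)) (nnsumD fp fq).
  by move=> t; rewrite normc_ge0 normc_le.
by exists s'.
Qed.

Lemma has_sum_exists T (f : T -> R[i]) s : nnsum (fun t => normc (f t)) s ->
  exists s', has_sum f s'.
Proof.
move=> fs.
have [|p fp] := nnsum_le (f := fun t => `|Re (f t)|) fs.
  by move=> t; rewrite normr_ge0 Re_le_normc.
have [|q fq] := nnsum_le (f := fun t => `|Im (f t)|) fs.
  by move=> t; rewrite normr_ge0 Im_le_normc.
have [p' fp'] := rhas_sum_exists fp; have [q' fq'] := rhas_sum_exists fq.
by exists (p' +i* q'); split.
Qed.

Lemma has_sum_pair T U (F : T * U -> R[i]) (A : T -> R[i]) s :
  has_sum F s -> (forall t, has_sum (fun u => F (t, u)) (A t)) -> has_sum A s.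
Proof.
move=> [F1 F2] FA; split.
- by apply: rhas_sum_pair F1 _ => t; exact: (FA t).1.
- by apply: rhas_sum_pair F2 _ => t; exact: (FA t).2.
Qed.

Lemma has_sum_reindex T U (e : T -> U) (f : U -> R[i]) s : bijective e ->
  has_sum f s -> has_sum (f \o e) s.
Proof.
move=> be [f1 f2]; split.
- exact: (rhas_sum_reindex be f1).
- exact: (rhas_sum_reindex be f2).
Qed.

(** Only the rows have to be evaluated: absolute convergence by rows provides
    the sum of the whole family, hence the columns and the sum of their sums. *)
Lemma has_sum_exchange T U (F : T -> U -> R[i]) (A : T -> R) (B : T -> R[i]) a :
  (forall t, nnsum (fun u => normc (F t u)) (A t)) -> nnsum A a ->
  (forall t, has_sum (F t) (B t)) ->
  exists2 C : U -> R[i], (forall u, has_sum (F ^~ u) (C u)) &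
    exists2 S, has_sum B S & has_sum C S.
Proof.
move=> FA Aa FB; have /(nnsum_pair a FA) Fa := Aa.
have [S FS] := has_sum_exists (f := fun p => F p.1 p.2) Fa.
pose sw (p : U * T) := (p.2, p.1).
have bsw : bijective sw by exists (fun p : T * U => (p.2, p.1)) => -[].
have FS' := has_sum_reindex bsw FS.
have /choice[C FC] : forall u, exists c, has_sum (F ^~ u) c.
  move=> u; have [s' Fs'] := nnsum_section u (nnsum_reindex bsw Fa).
  exact: has_sum_exists Fs'.
exists C => //; exists S; first exact: has_sum_pair FS _.
exact: has_sum_pair FS' _.
Qed.

(** An unconditional sum is in particular the limit of the symmetric partial
    sums by which [csum] is defined. *)
Lemma has_sum_csum (D : pred int) (f : int -> R[i]) s :
  has_sum (fun m => if D m then f m else 0) s -> csum D f = s.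
Proof.
move=> [f1 f2].
have cE N : cpartial D f N =
    \sum_(0 <= k < N.*2.+1) (fun m => if D m then f m else 0) (k%:Z - N%:Z).
  by rewrite /cpartial big_mkcond.
have ReS (N : nat) (g : nat -> R[i]) : Re (\sum_(0 <= k < N) g k) = \sum_(0 <= k < N) Re (g k).
  by rewrite (big_morph (@complex.Re R) ReD (erefl (Re 0))).
have ImS (N : nat) (g : nat -> R[i]) : Im (\sum_(0 <= k < N) g k) = \sum_(0 <= k < N) Im (g k).
  by rewrite (big_morph (@complex.Im R) ImD (erefl (Im 0))).
apply: complex_eq; rewrite /csum /=.
- under eq_fun do rewrite cE ReS.
  exact: (cvg_lim _ (rhas_sum_int f1)).
- under eq_fun do rewrite cE ImS.
  exact: (cvg_lim _ (rhas_sum_int f2)).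
Qed.

Lemma csummableP (D : pred int) (f : int -> R[i]) : csummable D f <->
  exists s, nnsum (fun m => if D m then normc (f m) else 0) s.
Proof.
rewrite /csummable /summable esum_mkcond.
have -> : (fun m : int => if m \in [set m0 | D m0] then `|(normc (f m))%:E|%E else 0%E) =
    (fun m => (if D m then normc (f m) else 0)%:E).
  apply/funext => m; rewrite mem_setE /in_mem/=.
  by case: ifP => //= _; rewrite ger0_norm// normc_ge0.
split=> [|[s [_ ->]]]; last exact: ltry.
by apply: nnsum_finite => m; case: ifP => // _; exact: normc_ge0.
Qed.

Lemma has_sum_csummable (D : pred int) (f : int -> R[i]) s :
  has_sum (fun m => if D m then f m else 0) s -> csummable D f.
Proof.
move=> /has_sum_abs[s' fs']; apply/csummableP; exists s'.
congr nnsum : fs'; apply/funext => m; case: ifP => //.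
by rewrite Normc.normc0.
Qed.

Lemma has_sum_delta T (t0 : T) (c : R[i]) :
  has_sum (fun t => if t == t0 then c else 0) c.
Proof.
have delta1 : nnsum (fun t => if t == t0 then 1 else 0) (1 : R).
  split; first by move=> t; case: ifP.
  rewrite (esumID [set t0]); last by move=> t _; case: ifP; rewrite lee_fin.
  rewrite setTI esum_set1 ?eqxx// esum1 ?adde0// => t [_ /eqP/negbTE ->//].
have := has_sumM c (has_sum_real (nnsum_rhas_sum delta1)).
rewrite mulr1; apply: eq_has_sum => t.
by case: ifP; rewrite ?mulr1 ?mulr0.
Qed.

Lemma has_sum0 T : has_sum (fun _ : T => 0) (0 : R[i]).
Proof. by split; apply: nnsum_rhas_sum; split => //; exact: esum1. Qed.

Lemma has_sum_big T (n : nat) (f : nat -> T -> R[i]) (s : nat -> R[i]) :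
  (forall k, has_sum (f k) (s k)) ->
  has_sum (fun t => \sum_(0 <= k < n) f k t) (\sum_(0 <= k < n) s k).
Proof.
move=> fs; elim: n => [|n IH].
  by rewrite big_nil; under eq_fun do rewrite big_nil; exact: has_sum0.
rewrite big_nat_recr//=; under eq_fun do rewrite big_nat_recr//=.
exact: has_sumD.
Qed.

Lemma has_sum_zsum (p q : int) (f : int -> R[i]) : p <= q ->
  has_sum (fun m => if p <= m <= q then f m else 0) (zsum p q f).
Proof.
move=> pq; have := has_sum_big `|q - p|%N.+1
  (fun k => has_sum_delta (p + k%:Z) (f (p + k%:Z))).
apply: eq_has_sum => m; case: ifP => [/andP[pm mq]|mpq].
- rewrite (bigD1_seq `|m - p|%N) ?iota_uniq//=; last by rewrite mem_index_iota; lia.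
  rewrite big1 ?addr0; last by move=> k kp; case: eqP => //; lia.
  have -> : p + `|m - p|%N%:Z = m by lia.
  by rewrite eqxx.
- rewrite big_nat_cond big1// => k /andP[kn _]; case: eqP => // mE.
  by move: mpq; lia.
Qed.

End ComplexSums.

(** * Derivatives of explicit functions *)
Section PointwiseDerivatives.
Variable R : realType.
Implicit Types (f g : R -> R) (x : R).

(** The rules are restated for functions written as abstractions, the form in
    which [deriv] meets them. *)
Lemma deriv_cst x (c : R) : is_derive x 1 (fun=> c) 0.
Proof. exact: is_derive_cst. Qed.

Lemma deriv_id x : is_derive x 1 (fun t : R => t) 1.
Proof. exact: is_derive_id. Qed.

Lemma deriv_add f g x (df dg : R) : is_derive x 1 f df -> is_derive x 1 g dg ->
  is_derive x 1 (fun t => f t + g t) (df + dg).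
Proof. by move=> ? ?; exact: is_deriveD. Qed.

Lemma deriv_opp f x (df : R) : is_derive x 1 f df ->
  is_derive x 1 (fun t => - f t) (- df).
Proof. by move=> ?; exact: is_deriveN. Qed.

Lemma deriv_mul f g x (df dg : R) : is_derive x 1 f df -> is_derive x 1 g dg ->
  is_derive x 1 (fun t => f t * g t) (df * g x + f x * dg).
Proof.
move=> ? ?; have -> : df * g x + f x * dg = f x *: dg + g x *: df.
  by rewrite /GRing.scale/= addrC [df * _]mulrC.
exact: is_deriveM.
Qed.

Lemma deriv_comp (F : R -> R) f x (df dF : R) : is_derive (f x) 1 F dF ->
  is_derive x 1 f df -> is_derive x 1 (fun t => F (f t)) (dF * df).
Proof. by move=> ? ?; exact: is_derive1_comp. Qed.

Lemma deriv_expR f x (df : R) : is_derive x 1 f df ->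
  is_derive x 1 (fun t => expR (f t)) (expR (f x) * df).
Proof. by move=> ?; exact: deriv_comp. Qed.

Lemma deriv_cos f x (df : R) : is_derive x 1 f df ->
  is_derive x 1 (fun t => cos (f t)) (- sin (f x) * df).
Proof. by move=> ?; exact: deriv_comp. Qed.

Lemma deriv_sin f x (df : R) : is_derive x 1 f df ->
  is_derive x 1 (fun t => sin (f t)) (cos (f x) * df).
Proof. by move=> ?; exact: deriv_comp. Qed.

Lemma deriv_continuous f : (forall x, exists d, is_derive x 1 f d) -> continuous f.
Proof.
move=> fd x; apply: differentiable_continuous; rewrite -derivable1_diffP.
by have [d []] := fd x.
Qed.

Lemma deriv_ext f g x (df dg : R) : f =1 g -> df = dg -> is_derive x 1 f df ->
  is_derive x 1 g dg.
Proof. by move=> /funext -> ->. Qed.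

End PointwiseDerivatives.

(** Base cases added to [deriv] once their derivatives are known. *)
Ltac deriv_atom := idtac.

(** The derivative may be an existential variable; it is then read off the syntax
    of the function. *)
Ltac deriv :=
  lazymatch goal with
  | |- is_derive _ _ (fun t => t) _ => eapply deriv_id
  | |- is_derive _ _ (fun t => @?f t + @?g t) _ =>
      eapply (@deriv_add _ f g); deriv
  | |- is_derive _ _ (fun t => - @?f t) _ => eapply (@deriv_opp _ f); deriv
  | |- is_derive _ _ (fun t => @?f t * @?g t) _ =>
      eapply (@deriv_mul _ f g); deriv
  | |- is_derive _ _ (fun t => expR (@?f t)) _ => eapply (@deriv_expR _ f); deriv
  | |- is_derive _ _ (fun t => cos (@?f t)) _ => eapply (@deriv_cos _ f); deriv
  | |- is_derive _ _ (fun t => sin (@?f t)) _ => eapply (@deriv_sin _ f); deriv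
  | |- is_derive _ _ ?f _ => first [eapply deriv_cst | deriv_atom]
  end.

(** * The integral representation of K on the whole line *)
Section Hyperbolic.
Variable R : realType.

Definition sinh (x : R) : R := (expR x - expR (- x)) / 2.

Lemma deriv_cosh (x : R) : is_derive x 1 (@cosh R) (sinh x).
Proof.
rewrite /cosh /sinh; eapply deriv_ext; [by []| |deriv].
by rewrite /=; ring.
Qed.

Lemma deriv_sinh (x : R) : is_derive x 1 sinh (cosh x).
Proof.
rewrite /cosh /sinh; eapply deriv_ext; [by []| |deriv].
by rewrite /=; ring.
Qed.

Lemma cosh_gt0 (x : R) : 0 < cosh x.
Proof. by rewrite divr_gt0// addr_gt0// expR_gt0. Qed.

Lemma coshN (x : R) : cosh (- x) = cosh x.
Proof. by rewrite /cosh opprK addrC. Qed.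

Lemma sinh_le_cosh (x : R) : `|sinh x| <= cosh x.
Proof.
rewrite ler_norml /sinh /cosh; have := expR_gt0 x; have := expR_gt0 (- x); lra.
Qed.

Lemma expR_le_cosh (x : R) : expR x <= 2 * cosh x.
Proof. by rewrite /cosh; have := expR_gt0 (- x); lra. Qed.

(** A growth faster than quadratic is what makes the kernel below smaller than a
    Gaussian; [e^x >= (1 + x/4)^4] gives it. *)
Lemma cosh_ge_quartic (x : R) : x ^+ 4 / 512 <= cosh x.
Proof.
have H (y : R) : 0 <= y -> y ^+ 4 / 256 <= expR y.
  move=> y0; have -> : expR y = expR (y / 4) ^+ 4.
    by rewrite -expRM_natl; congr expR; lra.
  have -> : y ^+ 4 / 256 = (y / 4) ^+ 4 by rewrite expr_div_n; congr (_ / _); ring.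
  rewrite lerXn2r ?nnegrE ?expR_ge0 ?divr_ge0//.
  by have := expR_ge1Dx (y / 4); lra.
wlog x0 : x / 0 <= x.
  move=> W; have [x0|x0] := leP 0 x; first exact: W.
  have := W (- x); rewrite coshN (_ : (- x) ^+ 4 = x ^+ 4); last by ring.
  by apply; lra.
by rewrite /cosh; have := H _ x0; have := expR_gt0 (- x); lra.
Qed.

End Hyperbolic.

Ltac deriv_atom ::= first [eapply deriv_cosh | eapply deriv_sinh | idtac].

Section BesselKernel.
Variable R : realType.
Local Notation mu := (@lebesgue_measure R).
Implicit Types (m x t : R).

(** Half of its integral over the line is [K_m x] ([besselKE]). *)
Definition kernel m x t : R := expR (m * t - x * cosh t).

Lemma kernel_ge0 m x t : 0 <= kernel m x t. Proof. exact: expR_ge0. Qed.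

Lemma deriv_kernel m x t : is_derive t 1 (kernel m x) (kernel m x t * (m - x * sinh t)).
Proof.
rewrite /kernel; eapply deriv_ext; [by []| |deriv].
by rewrite /=; ring.
Qed.

Lemma continuous_kernel m x : continuous (kernel m x).
Proof. by apply: deriv_continuous => t; eexists; exact: deriv_kernel. Qed.

(** One constant serves all orders up to [m] and all arguments beyond [x]: this
    uniformity is what differentiation under the integral sign requires. *)
Lemma kernel_gauss m x : 0 < x -> exists C, 0 <= C /\
  forall m' x' t, `|m'| <= m -> x <= x' -> kernel m' x' t <= C * gauss_fun t.
Proof.
move=> x0; exists (expR (m ^+ 2 / 2 + 288 / x)); split; first exact: expR_ge0.
move=> m' x' t m'm xx'; rewrite /kernel /gauss_fun -expRD ler_expR.
have := cosh_ge_quartic t; have c0 := cosh_gt0 t => ct.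
have h1 : x * (t ^+ 4 / 512) <= x' * cosh t.
  apply: ler_pM; [exact: ltW| |exact: xx'|exact: ct].
  by apply: divr_ge0; [exact: exprn_even_ge0|exact: ler0n].
(* completing the square in [t ^+ 2], to absorb [3/2 t^2] into [x t^4 / 512] *)
have h2 : 0 <= x / 512 * (t ^+ 2 - 384 / x) ^+ 2.
  apply: mulr_ge0; last exact: sqr_ge0.
  by apply: divr_ge0; [exact: ltW|exact: ler0n].
have h3 : x / 512 * (t ^+ 2 - 384 / x) ^+ 2 =
    x * (t ^+ 4 / 512) - 3 / 2 * t ^+ 2 + 288 / x by field; rewrite gt_eqF.
rewrite h3 in h2.
have h4 : m' * t <= m ^+ 2 / 2 + t ^+ 2 / 2.
  have m2 : m' ^+ 2 <= m ^+ 2.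
    by rewrite -[m' ^+ 2]real_normK ?num_real// lerXn2r ?nnegrE// (le_trans _ m'm).
  have := sqr_ge0 (m' - t); lra.
lra.
Qed.

Lemma continuous_measurable_EFin (D : set R) (f : R -> R) : continuous f ->
  measurable_fun D (EFin \o f).
Proof.
move=> fc; apply/measurable_EFinP; apply: measurable_funTS.
exact: continuous_measurable_fun.
Qed.

Lemma integrable_gauss_bound (f : R -> R) C : continuous f ->
  (forall t, `|f t| <= C * gauss_fun t) -> mu.-integrable setT (EFin \o f).
Proof.
move=> cf fC; apply: (@le_integrable _ _ _ mu setT _ _ (fun t => C%:E * (gauss_fun t)%:E)%E) => //.
- exact: continuous_measurable_EFin.
- move=> t _ /=; rewrite lee_fin (le_trans (fC t))//; exact: ler_norm.
- by apply: integrableZl => //; exact: integrableT_gauss.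
Qed.

Lemma integrable_kernel m x : 0 < x -> mu.-integrable setT (EFin \o kernel m x).
Proof.
move=> x0; have [C [C0 HC]] := kernel_gauss `|m| x0.
apply: (@integrable_gauss_bound _ C) => [|t]; first exact: continuous_kernel.
by rewrite ger0_norm ?kernel_ge0// HC.
Qed.

Lemma continuous_gauss_bound0 (f : R -> R) C : (forall t, `|f t| <= C * gauss_fun t) ->
  (fun n : nat => f n%:R) @ \oo --> (0 : R) /\ (fun n : nat => f (- n%:R)) @ \oo --> (0 : R).
Proof.
move=> fC.
have g0 : (fun n : nat => C * gauss_fun (n%:R : R)) @ \oo --> (0 : R).
  rewrite -[X in _ --> X](mulr0 C); apply: cvgM; first exact: cvg_cst.
  by have /cvg_pinftyP/(_ _ (@cvgr_idn R)) := @cvg_gauss_fun R.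
split; apply/norm_cvg0P.
  apply: (@squeeze_cvgr _ _ _ _ (fun=> 0) (fun n : nat => C * gauss_fun (n%:R : R))) => //.
  - by apply: nearW => n; rewrite normr_ge0 fC.
  - exact: cvg_cst.
apply: (@squeeze_cvgr _ _ _ _ (fun=> 0) (fun n : nat => C * gauss_fun (n%:R : R))) => //.
- apply: nearW => n; rewrite normr_ge0/= (le_trans (fC _))//.
  by rewrite /gauss_fun sqrrN.
- exact: cvg_cst.
Qed.

End BesselKernel.

Section BesselKLine.
Variable R : realType.
Local Notation mu := (@lebesgue_measure R).
Implicit Types (m x t : R).

(** Folding the negative half line onto the positive one. *)
Lemma integral_kernel_half m x : 0 < x ->
  (\int[mu]_t (kernel m x t)%:E =
   \int[mu]_(t in `[0%R, +oo[) (2 * (expR (- (x * cosh t)) * cosh (m * t)))%:E)%E.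
Proof.
move=> x0.
have mk m' (D : set R) : measurable_fun D (EFin \o kernel m' x).
  by apply: continuous_measurable_EFin; exact: continuous_kernel.
have -> : [set: R] = `]-oo, 0] `|` `]0, +oo[.
  apply/seteqP; split=> t //= _; rewrite !in_itv/= andbT.
  by have [h|h] := leP t 0; [left|right].
rewrite ge0_integral_setU//=; first last.
- apply/disj_setPS => t []/=; rewrite !in_itv/= andbT => h1 h2.
  by move: (le_lt_trans h1 h2); rewrite ltxx.
- by move=> t _; rewrite lee_fin kernel_ge0.
- exact: mk.
rewrite integral_itv_obnd_cbnd; last exact: mk.
have := @ge0_integration_by_substitutionNy R (kernel m x) 0; rewrite oppr0 => ->; last 2 first.
- by apply: continuous_subspaceT; exact: continuous_kernel.
- by move=> t _; exact: kernel_ge0.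
rewrite -ge0_integralD//; last 4 first.
- by move=> t _; rewrite lee_fin kernel_ge0.
- have -> : (fun t => ((kernel m x \o -%R) t)%:E) = EFin \o kernel (- m) x.
    by apply/funext => t; rewrite /= /kernel coshN mulrN mulNr.
  exact: mk.
- by move=> t _; rewrite lee_fin kernel_ge0.
- exact: mk.
apply: eq_integral => t _; rewrite -EFinD; congr EFin.
by rewrite /kernel /= coshN !expRD mulrN [cosh (m * t)]/cosh; lra.
Qed.

Lemma besselKE (n : int) x : 0 < x ->
  \int[mu]_t kernel n%:~R x t = 2 * besselK n x.
Proof.
move=> x0; rewrite /Rintegral integral_kernel_half//.
under eq_integral do rewrite EFinM.
rewrite ge0_integralZl//=; last 2 first.
- apply: continuous_measurable_EFin.
  by apply: deriv_continuous => t; rewrite /cosh; eexists; deriv.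
- by move=> t _; rewrite lee_fin mulr_ge0 ?expR_ge0 ?ltW ?cosh_gt0.
rewrite /besselK /Rintegral; set J := (\int[_]_(_ in _) _)%E.
have : (0 <= J)%E.
  by apply: integral_ge0 => t _; rewrite lee_fin mulr_ge0 ?expR_ge0 ?ltW ?cosh_gt0.
case: J => [r _|_|] //=; by rewrite gt0_muley ?lte_fin// mulr0.
Qed.

(** The kernel is bounded below on the unit interval. *)
Lemma integral_kernel_gt0 m x : 0 < x -> 0 < \int[mu]_t kernel m x t.
Proof.
move=> x0.
have ki := integrable_kernel m x0.
have i01 : measurable `[0%R, 1%R : R]%classic by exact: measurable_itv.
have kS : mu.-integrable `[0, 1] (EFin \o kernel m x).
  by apply: integrableS ki => //.
have le1 : \int[mu]_(t in `[0, 1]) kernel m x t <= \int[mu]_t kernel m x t.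
  rewrite /Rintegral; apply: fine_le.
  - exact: integrable_fin_num kS.
  - exact: integrable_fin_num ki.
  - apply: ge0_subset_integral => //.
    + by apply: continuous_measurable_EFin; exact: continuous_kernel.
    + by move=> t _; rewrite lee_fin kernel_ge0.
apply: lt_le_trans le1.
have c0 : 0 < expR (- `|m| - x * expR 1) :> R by exact: expR_gt0.
apply: (@lt_le_trans _ _ (\int[mu]_(t in `[0, 1]) expR (- `|m| - x * expR 1))).
  by rewrite Rintegral_cst// [X in fine X]lebesgue_measure_itv/= lte_fin ltr01 -EFinB subr0 mulr1.
apply: le_Rintegral => //.
  apply: continuous_compact_integrable; first exact: segment_compact.
  by apply: continuous_subspaceT; exact: cst_continuous.
move=> t; rewrite /= in_itv/= => /andP[t0 t1]; rewrite /kernel ler_expR lerB//.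
  have := ler_norm (- m); rewrite normrN => h1.
  have := normr_ge0 m; nra.
rewrite ler_pM2l// /cosh.
have e1 : expR t <= expR 1 by rewrite ler_expR.
have e2 : expR (- t) <= expR 1 by rewrite ler_expR; lra.
lra.
Qed.

Lemma besselK_gt0 (n : int) x : 0 < x -> 0 < besselK n x.
Proof.
by move=> x0; have := integral_kernel_gt0 n%:~R x0; rewrite besselKE// pmulr_rgt0.
Qed.

End BesselKLine.

(** * Integrals that do not depend on a parameter *)
Section ConstantFlow.
Variable R : realType.
Local Notation mu := (@lebesgue_measure R).

Lemma integral_symmetric_limit (f : R -> R) : mu.-integrable setT (EFin \o f) ->
  (fun n : nat => \int[mu]_(t in `[- n%:R, n%:R]) f t) @ \oo --> \int[mu]_t f t.
Proof.
move=> fi.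
pose S (n : nat) : set R := `[- n%:R, n%:R]%classic.
have mf : measurable_fun setT (EFin \o f) by case/integrableP : fi.
have [] := @dominated_convergence _ _ _ mu setT measurableT
  (fun n => (EFin \o f) \_ (S n)) (EFin \o f) (fun t => `|f t|%:E).
- move=> n; apply/(measurable_restrict (EFin \o f)) => //; first exact: measurable_itv.
  exact: measurable_funTS.
- done.
- apply: aeW => t _; apply: cvg_near_cst.
  near=> n; rewrite /patch mem_set//= /S/= in_itv/= -ler_norml.
  by near: n; exact: nbhs_infty_ger.
- by rewrite (_ : (fun _ => _) = abse \o (EFin \o f))//; exact: integrable_abse.
- apply: aeW => t n _ /=; rewrite /patch; case: ifP => _ //.
  by rewrite abse0 lee_fin.
move=> _ _; rewrite -[X in _ --> X]fineK; last exact: integrable_fin_num fi.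
move=> /fine_cvgP[_].
rewrite /Rintegral; apply: cvg_trans; apply: near_eq_cvg; apply: nearW => n /=.
by rewrite [in RHS]integral_mkcond.
Unshelve. all: by end_near. Qed.

(** If the derivative of [h] in the parameter is a derivative [d] in [t] of some [k]
    that vanishes at infinity, then the integral of [h] has derivative zero.  For
    [h] and [k] the components of a holomorphic function this is the independence
    of the integral from the horizontal line of integration. *)
Lemma integral_flow_constant (h d k : R -> R -> R) (u v C : R) :
  (forall a t : R, u < a < v -> is_derive a 1 (h ^~ t) (d a t)) ->
  (forall a t : R, u < a < v -> is_derive t 1 (k a) (d a t)) ->
  (forall a, u < a < v -> continuous (h a)) ->
  (forall a, u < a < v -> continuous (d a)) ->
  (forall a t : R, u < a < v -> `|h a t| <= C * gauss_fun t) ->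
  (forall a t : R, u < a < v -> `|d a t| <= C * gauss_fun t) ->
  (forall a t : R, u < a < v -> `|k a t| <= C * gauss_fun t) ->
  forall a b, u < a < v -> u < b < v ->
  \int[mu]_t h a t = \int[mu]_t h b t.
Proof.
move=> hd kd hc dc hC dC kC.
(* over [-n, n] the integral of [d] telescopes to [k n - k (- n)] *)
have int0 a : u < a < v -> \int[mu]_t d a t = 0.
  move=> uav.
  have di : mu.-integrable setT (EFin \o d a).
    by apply: (@integrable_gauss_bound _ _ C) => [|t]; [exact: dc|exact: dC].
  have := integral_symmetric_limit di.
  rewrite -(cvg_shiftS (fun n : nat => \int[mu]_(t in `[- n%:R, n%:R]) d a t)).
  have -> : (fun n : nat => \int[mu]_(t in `[- n.+1%:R, n.+1%:R]) d a t) =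
      (fun n : nat => k a n.+1%:R - k a (- n.+1%:R)).
    apply/funext => n; rewrite /Rintegral (@continuous_FTC2 _ (d a) (k a))//=.
    - by rewrite gtrN.
    - exact: continuous_subspaceT (dc _ uav).
    - have kcont : continuous (k a) by apply: deriv_continuous => t; eexists; exact: kd.
      split; first by move=> t _; have [] := kd a t uav.
        exact: cvg_at_right_filter (kcont _).
      exact: cvg_at_left_filter (kcont _).
    - by move=> t _; rewrite derive1E; have [_ ->] := kd a t uav.
  move=> lim1.
  have [k1 k2] := continuous_gauss_bound0 (fun t => kC a t uav).
  have lim0 : (fun n : nat => k a n.+1%:R - k a (- n.+1%:R)) @ \oo --> (0 - 0 : R).
    apply: cvgB; first by rewrite (cvg_shiftS (fun n : nat => k a n%:R)).
    by rewrite (cvg_shiftS (fun n : nat => k a (- n%:R))).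
  by rewrite -[RHS](subrr 0); apply: cvg_unique lim1 lim0; exact: norm_hausdorff.
have C0 : (exists a, u < a < v) -> 0 <= C.
  move=> [a uav]; have := le_trans (normr_ge0 _) (hC a 0 uav).
  by rewrite /gauss_fun expr0n oppr0 expR0 mulr1.
pose F a := \int[mu]_t h a t.
have Fd a : u < a < v -> is_derive a 1 F 0.
  move=> uav.
  have hi a' : `]u, v[%classic a' -> mu.-integrable setT (EFin \o h a').
    rewrite /= in_itv/= => ua'; apply: (@integrable_gauss_bound _ _ C) => [|t].
    + exact: hc.
    + exact: hC.
  have hder a' t : `]u, v[%classic a' -> [set: R] t -> derivable (h ^~ t) a' 1.
    by rewrite /= in_itv/= => ua' _; have [] := hd a' t ua'.
  have pE a' t : u < a' < v -> partial1of2 h a' t = d a' t.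
    by move=> ua'; rewrite partial1of2E; have [_ ->] := hd a' t ua'.
  have ia : `]u, v[%classic a by rewrite /= in_itv.
  have Gi : mu.-integrable setT (EFin \o (fun t => C * gauss_fun t)).
    apply: (@integrable_gauss_bound _ _ C) => [t|t].
      by apply: cvgM; [exact: cvg_cst|exact: continuous_gauss_fun].
    by rewrite ger0_norm// mulr_ge0 ?gauss_fun_ge0// C0//; exists a.
  have G0 t : 0 <= C * gauss_fun t by rewrite mulr_ge0 ?gauss_fun_ge0// C0//; exists a.
  have Gub a' t : `]u, v[%classic a' -> [set: R] t -> `|partial1of2 h a' t| <= C * gauss_fun t.
    by rewrite /= in_itv/= => ua' _; rewrite pE// dC.
  split.
    exact: (derivable_under_integral measurableT ia hi hder G0 Gi Gub).
  rewrite -derive1E (differentiation_under_integral measurableT ia hi hder G0 Gi Gub).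
  by rewrite -[RHS](int0 a)//; apply: eq_Rintegral => t _; exact: pE.
move=> a b ua ub; wlog ab : a b ua ub / a <= b.
  by move=> W; have [/W ->//|/ltW /W <-//] := leP a b.
move: ab; rewrite le_eqVlt => /orP[/eqP ->//|ab].
have inab t : t \in `[a, b] -> u < t < v.
  by rewrite in_itv/=; lra.
have [||c _] := @MVT _ F (fun=> 0) a b ab.
- by move=> t tab; apply: Fd; apply: inab; exact: subset_itv_oo_cc tab.
- apply: derivable_within_continuous => t tab.
  by have [] := Fd t (inab _ tab).
by rewrite mul0r => /eqP; rewrite subr_eq0 => /eqP.
Qed.

End ConstantFlow.

Section SumIntegral.
Variable R : realType.
Local Notation mu := (@lebesgue_measure R).

Lemma nnsum_integral (f : nat -> R -> R) (F : R -> R) :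
  (forall n, continuous (f n)) -> (forall t, nnsum (f ^~ t) (F t)) ->
  mu.-integrable setT (EFin \o F) ->
  nnsum (fun n => \int[mu]_t f n t) (\int[mu]_t F t).
Proof.
move=> fc fF Fi.
have f0 n t : 0 <= f n t by exact: (fF t).1.
have fi n : mu.-integrable setT (EFin \o f n).
  apply: le_integrable Fi => //.
  - exact: continuous_measurable_EFin.
  - move=> t _ /=; rewrite lee_fin !ger0_norm ?f0 ?(nnsum_ge0 (fF t))//.
    exact: nnsum_term_le (fF t).
have finE g : mu.-integrable setT (EFin \o g) ->
    (\int[mu]_t g t)%:E = (\int[mu]_t (g t)%:E)%E.
  by move=> gi; rewrite /Rintegral fineK//; exact: integrable_fin_num gi.
split; first by move=> n; apply: Rintegral_ge0.
rewrite finE// -nneseries_esumT; last by move=> n; rewrite lee_fin Rintegral_ge0.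
under eq_eseriesr do rewrite finE//.
rewrite -integral_nneseries//=; last 2 first.
- by move=> n; exact: continuous_measurable_EFin.
- by move=> n t _; rewrite lee_fin.
apply: eq_integral => t _; rewrite nneseries_esumT; last by move=> n; rewrite lee_fin.
exact: (fF t).2.
Qed.

(** Apply the nonnegative case to the dominating family [g] and to [g - f]. *)
Lemma rhas_sum_integral (f g : nat -> R -> R) (G F : R -> R) :
  (forall n, continuous (f n)) -> (forall n, continuous (g n)) ->
  (forall n t, `|f n t| <= g n t) -> (forall t, nnsum (g ^~ t) (G t)) ->
  mu.-integrable setT (EFin \o G) -> mu.-integrable setT (EFin \o F) ->
  (forall t, rhas_sum (f ^~ t) (F t)) ->
  rhas_sum (fun n => \int[mu]_t f n t) (\int[mu]_t F t).
Proof.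
move=> fc gc fg gG Gi Fi fF.
have H1 := nnsum_integral gc gG Gi.
have H2 : nnsum (fun n => \int[mu]_t (g n t - f n t)) (\int[mu]_t (G t - F t)).
  apply: nnsum_integral.
  - by move=> n t; apply: cvgB; [exact: gc|exact: fc].
  - move=> t; apply: rhas_sum_nnsum.
      by move=> n; rewrite subr_ge0 (le_trans (ler_norm _)).
    apply: rhas_sumD; first exact: nnsum_rhas_sum.
    exact: rhas_sumN.
  - rewrite (_ : EFin \o _ = ((EFin \o G) \- (EFin \o F))%E).
      exact: (integrableB measurableT Gi Fi).
    by apply/funext => t; rewrite /= EFinB.
have g0 n t : 0 <= g n t by exact: le_trans (fg n t).
have bi (h : R -> R) n : continuous h -> (forall t, `|h t| <= g n t) ->
    mu.-integrable setT (EFin \o h).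
  move=> hc hg; apply: le_integrable Gi => //.
  - exact: continuous_measurable_EFin.
  - move=> t _ /=; rewrite lee_fin (le_trans (hg t))//.
    by rewrite (le_trans (nnsum_term_le n (gG t)))//; exact: ler_norm.
exists (fun n => \int[mu]_t g n t), (fun n => \int[mu]_t (g n t - f n t)),
  (\int[mu]_t G t), (\int[mu]_t (G t - F t)); split => //.
- move=> n; rewrite RintegralB//; first by ring.
  + by apply: (bi _ n) => // t; rewrite ger0_norm.
  + exact: (bi _ n).
- by rewrite RintegralB//; ring.
Qed.

End SumIntegral.

(** * The complex exponential series *)
Section ComplexExponential.
Variable R : realType.
Implicit Types (z u : R[i]) (x t : R).

Definition cexp z : R[i] := (expR (Re z))%:C * cexpi (Im z).

Lemma nnsum_expR x : 0 <= x -> nnsum (fun n => x ^+ n / n`!%:R) (expR x).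
Proof.
move=> x0; apply: nnsum_cvg; first by move=> n; rewrite divr_ge0 ?exprn_ge0.
exact: is_cvg_series_exp_coeff.
Qed.

(** The coefficients of [t |-> Re (u e^{t z})]: carrying the factor [u] makes the
    family stable under differentiation, which replaces [u] by [u z]. *)
Let coef z u (n : nat) : R := Re (u * z ^+ n) / n`!%:R.

Let coef_sum z u K : exists s, rhas_sum (fun n => coef z u n * K ^+ n) s.
Proof.
have zK0 : 0 <= normc z * `|K| by rewrite mulr_ge0 ?normc_ge0.
have H := nnsum_mul (normc_ge0 u) (nnsum_expR zK0).
have [|s' Hs'] := nnsum_le (f := fun n => `|coef z u n * K ^+ n|) H.
  move=> n; rewrite normr_ge0/= /coef !normrM.
  rewrite [X in _ * X * _]ger0_norm ?invr_ge0// exprMn -normrX.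
  rewrite [leRHS]mulrA mulrAC ler_wpM2r ?invr_ge0//.
  by rewrite mulrA ler_wpM2r// (le_trans (Re_le_normc _))// Normc.normcM normcX.
exact: rhas_sum_exists Hs'.
Qed.

Let coef_cvg z u K : cvgn (pseries (coef z u) K).
Proof.
by have [s Hs] := coef_sum z u K; apply/cvg_ex; exists s; exact: rhas_sum_series.
Qed.

Let coef_diffs z u : pseries_diffs (coef z u) = coef z (u * z).
Proof.
apply/funext => n; rewrite /pseries_diffs /coef factS natrM invfM exprS !mulrA.
by rewrite [_%:R * _]mulrC -!mulrA [_%:R * (_ * _)]mulrA divff ?pnatr_eq0// mul1r !mulrA.
Qed.

Let exppart z u (t : R) : R := limn (pseries (coef z u) t).

Let exppart_sum z u t : rhas_sum (fun n => coef z u n * t ^+ n) (exppart z u t).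
Proof.
have [s Hs] := coef_sum z u t.
by rewrite /exppart (cvg_lim _ (rhas_sum_series Hs)).
Qed.

Let deriv_exppart z u t : is_derive t 1 (exppart z u) (exppart z (u * z) t).
Proof.
rewrite /exppart -coef_diffs; apply: (@pseries_snd_diffs _ _ (`|t| + 1)).
- exact: coef_cvg.
- by rewrite coef_diffs; exact: coef_cvg.
- by rewrite !coef_diffs; exact: coef_cvg.
- by rewrite [ltRHS]ger0_norm ?addr_ge0// ltrDl.
Qed.

Let exppart_linear z u t : exppart z u t = Re u * exppart z 1 t - Im u * exppart z (- 'i) t.
Proof.
apply: rhas_sum_uniq (exppart_sum z u t) _.
have H := rhas_sumD (rhas_sumM (Re u) (exppart_sum z 1 t))
                    (rhas_sumN (rhas_sumM (Im u) (exppart_sum z (- 'i) t))).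
congr (rhas_sum _ _) : H; apply/funext => n; rewrite /coef !ReM /=; ring.
Qed.

Let exppart0 z u : exppart z u 0 = Re u.
Proof.
apply: rhas_sum_uniq (exppart_sum z u 0) _.
have [H _] := has_sum_delta 0%N (Re u)%:C.
congr (rhas_sum _ _) : H; apply/funext => -[|n] /=.
  by rewrite /coef !expr0 mulr1 fact0 divr1 mulr1.
by rewrite exprS mul0r mulr0.
Qed.

(** [A] and [B] solve the linear system of [e^{a t} cos (b t)] and
    [e^{a t} sin (b t)]; undoing the rotation and the growth leaves two functions
    with derivative zero. *)
Let exppartE z t : exppart z 1 t = expR (Re z * t) * cos (Im z * t) /\
  exppart z (- 'i) t = expR (Re z * t) * sin (Im z * t).
Proof.
pose a := Re z; pose b := Im z.
pose A := exppart z 1; pose B := exppart z (- 'i).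
have dA (s : R) : is_derive s 1 A (a * A s - b * B s).
  by have := deriv_exppart z 1 s; rewrite mul1r exppart_linear.
have dB (s : R) : is_derive s 1 B (b * A s + a * B s).
  have := deriv_exppart z (- 'i) s; rewrite exppart_linear ReM ImM /= -/a -/b => H.
  by apply: deriv_ext H => //; rewrite -/(A s) -/(B s); ring.
have dP (s : R) : is_derive s 1 (fun t => expR (- (a * t)) * (A t * cos (b * t) + B t * sin (b * t))) 0.
  eapply deriv_ext; [by []| |deriv; [exact: dA|exact: dB]].
  by rewrite /=; ring.
have dQ (s : R) : is_derive s 1 (fun t => expR (- (a * t)) * (B t * cos (b * t) + - (A t * sin (b * t)))) 0.
  eapply deriv_ext; [by []| |deriv; [exact: dB|exact: dA]].
  by rewrite /=; ring.
have := is_derive_0_is_cst t 0 dP; have := is_derive_0_is_cst t 0 dQ.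
rewrite /= !mulr0 oppr0 expR0 cos0 sin0 !mulr0 !mulr1 !mul1r oppr0 !addr0.
rewrite /A /B !exppart0 /= oppr0 -/A -/B => hQ hP.
have e1 : expR (a * t) * expR (- (a * t)) = 1 by rewrite expRN divff// gt_eqF ?expR_gt0.
have cs := cos2Dsin2 (b * t).
split.
- have -> : A t = expR (a * t) * cos (b * t) *
      (expR (- (a * t)) * (A t * cos (b * t) + B t * sin (b * t))) -
      expR (a * t) * sin (b * t) *
      (expR (- (a * t)) * (B t * cos (b * t) + - (A t * sin (b * t)))).
    rewrite [RHS](_ : _ = expR (a * t) * expR (- (a * t)) * (cos (b * t) ^+ 2 + sin (b * t) ^+ 2) * A t).
      by rewrite e1 cs !mul1r.
    ring.
  by rewrite hP hQ; ring.
- have -> : B t = expR (a * t) * sin (b * t) *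
      (expR (- (a * t)) * (A t * cos (b * t) + B t * sin (b * t))) +
      expR (a * t) * cos (b * t) *
      (expR (- (a * t)) * (B t * cos (b * t) + - (A t * sin (b * t)))).
    rewrite [RHS](_ : _ = expR (a * t) * expR (- (a * t)) * (cos (b * t) ^+ 2 + sin (b * t) ^+ 2) * B t).
      by rewrite e1 cs !mul1r.
    ring.
  by rewrite hP hQ; ring.
Qed.

Lemma has_sum_cexp z : has_sum (fun n => z ^+ n / n`!%:R) (cexp z).
Proof.
have [h1 h2] := exppartE z 1; rewrite !mulr1 in h1 h2.
have [H1 H2] := (exppart_sum z 1 1, exppart_sum z (- 'i) 1).
split; rewrite /cexp ?ReM ?ImM /= !mul0r ?subr0 ?addr0.
- rewrite -h1; congr (rhas_sum _ _) : H1; apply/funext => n.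
  by rewrite /coef mul1r expr1n mulr1 natC -fmorphV ReM /= mulr0 subr0.
- rewrite -h2; congr (rhas_sum _ _) : H2; apply/funext => n.
  rewrite /coef expr1n mulr1 natC -fmorphV ReM ImM /= mulr0 add0r.
  by rewrite oppr0 mul0r sub0r mulN1r opprK.
Qed.

Lemma cexpD z u : cexp (z + u) = cexp z * cexp u.
Proof. by rewrite /cexp ReD ImD expRD rmorphM cexpiD /=; ring. Qed.

Lemma normc_cexp z : normc (cexp z) = expR (Re z).
Proof. by rewrite Normc.normcM normc_cexpi mulr1 normc_real ger0_norm// expR_ge0. Qed.

End ComplexExponential.

(** * Rotating and shifting the line of integration *)
Section RotateShift.
Variable R : realType.
Local Notation mu := (@lebesgue_measure R).
Implicit Types (m x t : R).

Lemma kernel_monotone m x y t : x <= y -> kernel m y t <= kernel m x t.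
Proof. by move=> xy; rewrite ler_expR lerB// ler_wpM2r// ltW// cosh_gt0. Qed.

(** A factor [cosh t] costs half of the exponential decay, as [y <= e^y]. *)
Lemma cosh_kernel m e t : 0 < e -> cosh t * kernel m e t <= 2 / e * kernel m (e / 2) t.
Proof.
move=> e0.
have -> : kernel m e t = kernel m (e / 2) t * expR (- (e / 2 * cosh t)).
  by rewrite /kernel -expRD; congr expR; field.
rewrite mulrCA mulrC ler_wpM2r ?kernel_ge0// expRN ler_pdivrMr ?expR_gt0//.
rewrite mulrC -ler_pdivrMr ?divr_gt0// invf_div.
have := expR_ge1Dx (e / 2 * cosh t); lra.
Qed.

Lemma cos_ge_cos (a A : R) : - A < a < A -> A < pi / 2 -> cos A <= cos a.
Proof.
move=> aA A2; have aA' : `|a| < A by rewrite ltr_norml.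
have p0 := pi_gt0 R.
have a0 := normr_ge0 a.
by rewrite -(cos_norm a) ltW// ltr_cos// in_itv/=; lra.
Qed.

(** The real part of [int e^{m (t - i a)} e^{- x cosh (t - i a)} dt], turned by the
    phase [dl]: moving the line of integration does not change it.  The phase
    [pi / 2] yields the imaginary part. *)
Lemma integral_kernel_rotate m x a dl : 0 < x -> - (pi / 2) < a < pi / 2 ->
  \int[mu]_t (kernel m (x * cos a) t * cos (x * sin a * sinh t - m * a - dl)) =
  \int[mu]_t (kernel m x t * cos dl).
Proof.
move=> x0 a2.
pose ph b t := x * sin b * sinh t - m * b - dl.
(* a strip strictly inside [|a| < pi / 2], where [cos] stays above [cos A] *)
pose A := (`|a| + pi / 2) / 2.
have na2 : `|a| < pi / 2 by rewrite ltr_norml.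
have p0 := pi_gt0 R; have na0 := normr_ge0 a.
have aA : - A < a < A by rewrite -ltr_norml /A; lra.
have A2 : A < pi / 2 by rewrite /A; lra.
have zA : - A < 0 < A by rewrite /A; lra.
pose e := x * cos A.
have e0 : 0 < e by rewrite mulr_gt0// cos_gt0_pihalf//; rewrite /A; lra.
have [C [C0 HC]] := @kernel_gauss R `|m| (e / 2) (divr_gt0 e0 (ltr0n _ 2)).
pose D := 4 * x / e + `|m| + 1.
have D0 : 0 <= 4 * x / e by apply: divr_ge0; [apply: mulr_ge0 => //; exact: ltW|exact: ltW].
have m0 := normr_ge0 m.
have kC b t : - A < b < A -> kernel m (x * cos b) t <= D * C * gauss_fun t.
  move=> bA; apply: (@le_trans _ _ (1 * kernel m (e / 2) t)).
    rewrite mul1r; apply: kernel_monotone.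
    have : e <= x * cos b by rewrite ler_pM2l// cos_ge_cos.
    by lra.
  rewrite -mulrA; apply: ler_pM; rewrite ?kernel_ge0//; last exact: HC.
  by rewrite /D; lra.
have kcC b t (u : R) : - A < b < A -> `|u| <= 2 * x * cosh t + `|m| ->
    `|kernel m (x * cos b) t * u| <= D * C * gauss_fun t.
  move=> bA hu; rewrite normrM (ger0_norm (kernel_ge0 _ _ _)).
  have be : e <= x * cos b by rewrite ler_pM2l// cos_ge_cos.
  apply: (@le_trans _ _ (kernel m e t * (2 * x * cosh t + `|m|))).
    by apply: ler_pM; rewrite ?kernel_ge0//; exact: kernel_monotone.
  apply: (@le_trans _ _ (D * kernel m (e / 2) t)); last first.
    rewrite -mulrA ler_wpM2l//; first by rewrite /D; lra.
    exact: HC.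
  have h1 : 2 * x * (cosh t * kernel m e t) <= 2 * x * (2 / e * kernel m (e / 2) t).
    by rewrite ler_wpM2l ?cosh_kernel// mulr_ge0// ltW.
  have h2 : `|m| * kernel m e t <= `|m| * kernel m (e / 2) t.
    by rewrite ler_wpM2l//; apply: kernel_monotone; lra.
  have := kernel_ge0 m (e / 2) t.
  have -> : D * kernel m (e / 2) t = 2 * x * (2 / e * kernel m (e / 2) t) +
     `|m| * kernel m (e / 2) t + kernel m (e / 2) t by rewrite /D; field; rewrite gt_eqF.
  lra.
have tr (c : R) : `|c| <= 1 -> forall u, `|u * c| <= `|u|.
  by move=> c1 u; rewrite normrM ler_piMr.
pose h b t := kernel m (x * cos b) t * cos (ph b t).
pose k b t := kernel m (x * cos b) t * sin (ph b t).
pose d b t := kernel m (x * cos b) t *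
  (x * sin b * cosh t * cos (ph b t) - (x * cos b * sinh t - m) * sin (ph b t)).
have dcont b : continuous (d b).
  by apply: deriv_continuous => t; rewrite /d /kernel /ph; eexists; deriv.
have hcont b : continuous (h b).
  by apply: deriv_continuous => t; rewrite /h /kernel /ph; eexists; deriv.
have hk b t (c : R) : - A < b < A -> `|c| <= 1 -> `|kernel m (x * cos b) t * c| <= D * C * gauss_fun t.
  move=> bA c1; apply: le_trans (kC b t bA); rewrite normrM (ger0_norm (kernel_ge0 _ _ _)).
  by rewrite ler_piMr// kernel_ge0.
have h0 : \int[mu]_t h 0 t = \int[mu]_t (kernel m x t * cos dl).
  apply: eq_Rintegral => t _; rewrite /h /ph cos0 sin0 !mulr0 mulr1 mul0r.
  by rewrite oppr0 !add0r cosN.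
rewrite -h0; apply: (@integral_flow_constant R h d k (- A) A (D * C)) => //.
- move=> b t bA; rewrite /h /d /kernel /ph; eapply deriv_ext; [by []| |deriv].
  by rewrite /=; ring.
- move=> b t bA; rewrite /k /d /kernel /ph; eapply deriv_ext; [by []| |deriv].
  by rewrite /=; ring.
- by move=> b t bA; apply: hk => //; exact: cos_max.
- move=> b t bA; apply: kcC => //.
  have ct := cosh_gt0 t.
  have b1 : `|x * sin b * cosh t * cos (ph b t)| <= x * cosh t.
    rewrite (le_trans (tr _ (cos_max _) _))// mulrAC (le_trans (tr _ (sin_max _) _))//.
    by rewrite normrM !gtr0_norm.
  have b2 : `|(x * cos b * sinh t - m) * sin (ph b t)| <= x * cosh t + `|m|.
    rewrite (le_trans (tr _ (sin_max _) _))// (le_trans (ler_normB _ _))// lerD2r.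
    rewrite mulrAC (le_trans (tr _ (cos_max _) _))// normrM gtr0_norm// ler_pM2l//.
    exact: sinh_le_cosh.
  by rewrite (le_trans (ler_normB _ _))//; lra.
- by move=> b t bA; apply: hk => //; exact: sin_max.
Qed.

Lemma integral_kernel_shift m x a : 0 < x ->
  \int[mu]_t kernel m x (t + a) = \int[mu]_t kernel m x t.
Proof.
move=> x0.
suff E : (\int[mu]_t (kernel m x (t + a))%:E = \int[mu]_t (kernel m x t)%:E)%E.
  by rewrite /Rintegral E.
have dF t : is_derive t 1 (fun t : R => t + a) 1.
  by eapply deriv_ext; [by []| |deriv]; rewrite addr0.
have dFE : derive1 (fun t : R => t + a) = cst 1.
  by apply/funext => t; rewrite derive1E; have [_ ->] := dF t.
rewrite [RHS](@increasing_ge0_integration_by_substitutionT R (fun t => t + a) (kernel m x)).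
- by apply: eq_integral => t _; rewrite dFE /= !fctE mulr1.
- by move=> s t st; rewrite ltrD2r.
- by rewrite dFE; exact: cst_continuous.
- by rewrite dFE; exact: is_cvg_cst.
- by rewrite dFE; exact: is_cvg_cst.
- by move=> t; have [] := dF t.
- exact: cvg_addrr_Ny.
- exact: cvg_addrr.
- exact: continuous_kernel.
- by move=> t; exact: kernel_ge0.
Qed.

End RotateShift.

(** * Graf's addition theorem *)
Section ComplexIntegrals.
Variable R : realType.
Local Notation mu := (@lebesgue_measure R).
Implicit Types (f : R -> R[i]).

Definition ccontinuous f : Prop :=
  continuous (fun t => Re (f t)) /\ continuous (fun t => Im (f t)).

Lemma ccontinuous_cst (c : R[i]) : ccontinuous (fun=> c).
Proof. by split; exact: cst_continuous. Qed.

Lemma ccontinuous_real (r : R -> R) : continuous r -> ccontinuous (fun t => (r t)%:C).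
Proof. by move=> rc; split => //=; exact: cst_continuous. Qed.

Lemma ccontinuousM f g : ccontinuous f -> ccontinuous g -> ccontinuous (fun t => f t * g t).
Proof.
move=> [f1 f2] [g1 g2]; split => t.
- by under eq_fun do rewrite ReM; apply: cvgB; apply: cvgM;
    [exact: f1|exact: g1|exact: f2|exact: g2].
- by under eq_fun do rewrite ImM; apply: cvgD; apply: cvgM;
    [exact: f1|exact: g2|exact: f2|exact: g1].
Qed.

Lemma ccontinuous_cexp f : ccontinuous f -> ccontinuous (fun t => cexp (f t)).
Proof.
move=> [f1 f2]; apply: ccontinuousM.
  apply: ccontinuous_real => t; apply: continuous_comp; first exact: f1.
  exact: continuous_expR.
split=> t /=; apply: (continuous_comp (f := fun t => Im (f t))).
- exact: f2.
- exact: continuous_cos.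
- exact: f2.
- exact: continuous_sin.
Qed.

Lemma has_sum_cintegral (f : nat -> R -> R[i]) (g : nat -> R -> R) (G B : R -> R)
    (F : R -> R[i]) :
  (forall n, ccontinuous (f n)) -> ccontinuous F -> (forall n, continuous (g n)) ->
  (forall n t, normc (f n t) <= g n t) -> (forall t, nnsum (g ^~ t) (G t)) ->
  (forall t, normc (F t) <= B t) ->
  mu.-integrable setT (EFin \o G) -> mu.-integrable setT (EFin \o B) ->
  (forall t, has_sum (f ^~ t) (F t)) ->
  has_sum (fun n => cintegral mu (f n)) (cintegral mu F).
Proof.
move=> fc [F1 F2] gc fg gG FB Gi Bi fF.
have Fi (h : R -> R) : continuous h -> (forall t, `|h t| <= normc (F t)) ->
    mu.-integrable setT (EFin \o h).
  move=> hc hF; apply: le_integrable Bi => //; first exact: continuous_measurable_EFin.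
  move=> t _ /=; rewrite lee_fin (le_trans (hF t))// (le_trans (FB t))//; exact: ler_norm.
split; apply: (rhas_sum_integral (g := g) (G := G)) => //.
- by move=> n; exact: (fc n).1.
- by move=> n t; rewrite (le_trans (Re_le_normc _)).
- by apply: Fi => // t; exact: Re_le_normc.
- by move=> t; exact: (fF t).1.
- by move=> n; exact: (fc n).2.
- by move=> n t; rewrite (le_trans (Im_le_normc _)).
- by apply: Fi => // t; exact: Im_le_normc.
- by move=> t; exact: (fF t).2.
Qed.

Lemma cintegralMr (c : R[i]) (r : R -> R) : mu.-integrable setT (EFin \o r) ->
  cintegral mu (fun t => c * (r t)%:C) = c * (\int[mu]_t r t)%:C.
Proof.
move=> ri; apply: complex_eq; rewrite /cintegral ?ReM ?ImM /= !mulr0.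
- by under eq_Rintegral do rewrite ReM /= mulr0 subr0; rewrite subr0 RintegralZl.
- by under eq_Rintegral do rewrite ImM /= mulr0 add0r; rewrite add0r RintegralZl.
Qed.

End ComplexIntegrals.

Section Graf.
Variable R : realType.
Local Notation mu := (@lebesgue_measure R).

Lemma normc_powfact (p : R[i]) P n : normc p = P ->
  normc (p ^+ n / n`!%:R) = P ^+ n / n`!%:R.
Proof. by move=> pP; rewrite Normc.normcM normcX Normc.normcV natC normc_real ger0_norm ?pP. Qed.

Variables (m : int) (x y : R) (p q : R[i]).
Hypotheses (y0 : 0 <= y) (yx : y < x).
Hypotheses (pP : normc p = y / 2) (qP : normc q = y / 2).
Let P := y / 2.

Let x0 : 0 < x. Proof. exact: le_lt_trans yx. Qed.
Let xy0 : 0 < x - y. Proof. by rewrite subr_gt0. Qed.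
Let P0 : 0 <= P. Proof. by rewrite divr_ge0. Qed.

Let kernel_powers (j k : nat) (t : R) :
  kernel (m + j%:Z - k%:Z)%:~R x t = kernel m%:~R x t * expR t ^+ j * expR (- t) ^+ k.
Proof.
rewrite -!expRM_natl /kernel -!expRD; congr expR.
by rewrite intrB intrD -!pmulrn; ring.
Qed.

Let kernel_sub (t : R) :
  kernel m%:~R (x - y) t = kernel m%:~R x t * expR (P * expR t) * expR (P * expR (- t)).
Proof.
by rewrite /kernel -!expRD; congr expR; rewrite /cosh /P; field.
Qed.

(** With [p = (y / 2) e^{i psi}] and [q] its conjugate this is
    [e^{m t}] times the exponential of
    [- ((x - y e^{i psi}) e^t + (x - y e^{- i psi}) e^{- t}) / 2]. *)
Definition graf_kernel (t : R) : R[i] :=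
  (kernel m%:~R x t)%:C * cexp (p * (expR t)%:C) * cexp (q * (expR (- t))%:C).

Let coef (j k : nat) : R[i] := p ^+ j / j`!%:R * (q ^+ k / k`!%:R).
Let rcoef (j k : nat) : R := P ^+ j / j`!%:R * (P ^+ k / k`!%:R).

(* [f] expands both exponentials, [F] only the second; [g] and [G] are their
   majorants *)
Let g k j t := rcoef j k * kernel (m + j%:Z - k%:Z)%:~R x t.
Let G k t := P ^+ k / k`!%:R * (kernel (m - k%:Z)%:~R x t * expR (P * expR t)).
Let f k j t := coef j k * (kernel (m + j%:Z - k%:Z)%:~R x t)%:C.
Let F k t := q ^+ k / k`!%:R * ((kernel (m - k%:Z)%:~R x t)%:C * cexp (p * (expR t)%:C)).

Let kernel_powers0 (k : nat) (t : R) :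
  kernel (m - k%:Z)%:~R x t = kernel m%:~R x t * expR (- t) ^+ k.
Proof. by have := kernel_powers 0 k t; rewrite addr0 expr0 mulr1. Qed.

Let g_sum k t : nnsum (g k ^~ t) (G k t).
Proof.
have PE0 : 0 <= P * expR t by rewrite mulr_ge0 ?expR_ge0.
have c0 : 0 <= P ^+ k / k`!%:R * kernel (m - k%:Z)%:~R x t.
  by rewrite mulr_ge0 ?kernel_ge0// divr_ge0 ?exprn_ge0.
have := nnsum_mul c0 (nnsum_expR PE0).
have -> : G k t = P ^+ k / k`!%:R * kernel (m - k%:Z)%:~R x t * expR (P * expR t).
  by rewrite /G mulrA.
move=> H; congr (nnsum _ _) : H; apply/funext => j.
rewrite /g /rcoef kernel_powers kernel_powers0 [(P * expR t) ^+ _]exprMn; ring.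
Qed.

Let G_sum t : nnsum (G ^~ t) (kernel m%:~R (x - y) t).
Proof.
have PE0 : 0 <= P * expR (- t) by rewrite mulr_ge0 ?expR_ge0.
have c0 : 0 <= kernel m%:~R x t * expR (P * expR t).
  by apply: mulr_ge0; [exact: kernel_ge0|exact: expR_ge0].
have := nnsum_mul c0 (nnsum_expR PE0).
rewrite -kernel_sub => H; congr (nnsum _ _) : H; apply/funext => k.
rewrite /G kernel_powers0 [(P * expR (- t)) ^+ _]exprMn; ring.
Qed.

Let G_continuous k : continuous (G k).
Proof. by apply: deriv_continuous => t; rewrite /G /kernel; eexists; deriv. Qed.

Let GG_integrable : mu.-integrable setT (EFin \o kernel m%:~R (x - y)).
Proof. exact: integrable_kernel. Qed.

Let G_integrable k : mu.-integrable setT (EFin \o G k).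
Proof.
apply: le_integrable GG_integrable => //; first exact: continuous_measurable_EFin.
move=> t _ /=; rewrite lee_fin !ger0_norm ?kernel_ge0 ?(nnsum_ge0 (g_sum k t))//.
exact: nnsum_term_le (G_sum t).
Qed.

Let g_continuous k j : continuous (g k j).
Proof. by apply: deriv_continuous => t; rewrite /g /kernel; eexists; deriv. Qed.

Let normc_coef j k : normc (coef j k) = rcoef j k.
Proof. by rewrite Normc.normcM !(normc_powfact _ (P := P)). Qed.

Let kernel_integral (j k : nat) : \int[mu]_t kernel (m + j%:Z - k%:Z)%:~R x t =
  2 * besselK (m + j%:Z - k%:Z) x.
Proof. exact: besselKE. Qed.

(** [|p| = |q| = y / 2], so the moduli are the expansion at [psi = 0], where the
    integrand is the kernel of argument [x - y]. *)
Lemma graf_abs : exists2 A : nat -> R,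
  forall k, nnsum (fun j => normc (coef j k) * (2 * besselK (m + j%:Z - k%:Z) x)) (A k) &
  nnsum A (2 * besselK m (x - y)).
Proof.
exists (fun k => \int[mu]_t G k t).
  move=> k; have H := nnsum_integral (@g_continuous k) (g_sum k) (G_integrable k).
  congr (nnsum _ _) : H; apply/funext => j; rewrite /g RintegralZl//; last exact: integrable_kernel.
  by rewrite kernel_integral normc_coef.
by rewrite -besselKE//; exact: nnsum_integral.
Qed.

Let Re_le_expR (z : R[i]) (s : R) : normc z = P -> Re (z * (expR s)%:C) <= P * expR s.
Proof.
move=> zP; rewrite (le_trans (ler_norm _))// (le_trans (Re_le_normc _))//.
by rewrite Normc.normcM normc_real zP ger0_norm ?expR_ge0.
Qed.

Let F_le k t : normc (F k t) <= G k t.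
Proof.
rewrite /F Normc.normcM (normc_powfact _ qP) Normc.normcM normc_cexp normc_real.
rewrite ger0_norm ?kernel_ge0// /G -/P ler_wpM2l ?divr_ge0 ?exprn_ge0//.
by rewrite ler_wpM2l ?kernel_ge0// ler_expR Re_le_expR.
Qed.

Let graf_kernel_le t : normc (graf_kernel t) <= kernel m%:~R (x - y) t.
Proof.
rewrite /graf_kernel 2!Normc.normcM !normc_cexp normc_real ger0_norm ?kernel_ge0//.
rewrite kernel_sub; apply: ler_pM.
- by apply: mulr_ge0; [exact: kernel_ge0|exact: expR_ge0].
- exact: expR_ge0.
- apply: ler_wpM2l; first exact: kernel_ge0.
  by rewrite ler_expR; exact: Re_le_expR.
- by rewrite ler_expR; exact: Re_le_expR.
Qed.

Let cexp_continuous (z : R[i]) (r : R -> R) : continuous r ->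
  ccontinuous (fun t => cexp (z * (expR (r t))%:C)).
Proof.
move=> rc; apply: ccontinuous_cexp; apply: ccontinuousM; first exact: ccontinuous_cst.
apply: ccontinuous_real => t; apply: continuous_comp; first exact: rc.
exact: continuous_expR.
Qed.

Let F_continuous k : ccontinuous (F k).
Proof.
apply: ccontinuousM; first exact: ccontinuous_cst.
apply: ccontinuousM; first by apply: ccontinuous_real; exact: continuous_kernel.
by apply: (cexp_continuous _ (r := fun t => t)) => t; exact: cvg_id.
Qed.

Let graf_kernel_continuous : ccontinuous graf_kernel.
Proof.
apply: ccontinuousM.
  apply: ccontinuousM; first by apply: ccontinuous_real; exact: continuous_kernel.
  by apply: (cexp_continuous _ (r := fun t => t)) => t; exact: cvg_id.
by apply: (cexp_continuous _ (r := fun t => - t)) => t; apply: cvgN; exact: cvg_id.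
Qed.

(** The two exponentials are expanded one after the other, each time exchanging
    the series and the integral. *)
Lemma graf_sum : exists2 B : nat -> R[i],
  forall k, has_sum (fun j => coef j k * (2 * besselK (m + j%:Z - k%:Z) x)%:C) (B k) &
  has_sum B (cintegral mu graf_kernel).
Proof.
have expC (s : R) n : (expR s)%:C ^+ n = (expR s ^+ n)%:C :> R[i] by rewrite rmorphXn.
exists (fun k => cintegral mu (F k)).
  move=> k; have := @has_sum_cintegral R (f k) (g k) (G k) (G k) (F k).
  have fE : (fun n => cintegral mu (f k n)) =
      (fun j => coef j k * (2 * besselK (m + j%:Z - k%:Z) x)%:C).
    apply/funext => j; rewrite -kernel_integral /f cintegralMr//.
    exact: integrable_kernel.
  rewrite fE; apply => //.
  - move=> j; apply: ccontinuousM; first exact: ccontinuous_cst.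
    by apply: ccontinuous_real; exact: continuous_kernel.
  - move=> j t; rewrite /f Normc.normcM normc_coef normc_real ger0_norm ?kernel_ge0//.
  - move=> t; have := has_sumM (q ^+ k / k`!%:R * (kernel (m - k%:Z)%:~R x t)%:C)
      (has_sum_cexp (p * (expR t)%:C)).
    have -> : F k t = q ^+ k / k`!%:R * (kernel (m - k%:Z)%:~R x t)%:C *
        cexp (p * (expR t)%:C) by rewrite /F mulrA.
    apply: eq_has_sum => j.
    by rewrite /f /coef kernel_powers kernel_powers0 exprMn expC !rmorphM /=; ring.
apply: (has_sum_cintegral (g := G) (G := kernel m%:~R (x - y)) (B := kernel m%:~R (x - y))) => //.
move=> t; have := has_sumM ((kernel m%:~R x t)%:C * cexp (p * (expR t)%:C))
   (has_sum_cexp (q * (expR (- t))%:C)).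
apply: eq_has_sum => k.
by rewrite /F kernel_powers0 exprMn expC !rmorphM /=; ring.
Qed.

End Graf.

Section GrafTheorem.
Variable R : realType.
Local Notation mu := (@lebesgue_measure R).

(** Comparison with the exponential series, as [(k + n)! >= 1]. *)
Lemma nnsum_besselI (n : int) (y : R) : 0 <= y ->
  nnsum (fun k : nat => (y / 2) ^+ (k.*2 + `|n|)%N / (k`! * (k + `|n|)`!)%N%:R)
        (besselI n y).
Proof.
move=> y0; have h0 : 0 <= y / 2 by rewrite divr_ge0.
have hX (k : nat) : 0 <= (y / 2) ^+ k by rewrite exprn_ge0.
have H := nnsum_mul (hX `|n|%N) (nnsum_expR (hX 2%N)).
have [|s Hs] := nnsum_le
   (f := fun k : nat => (y / 2) ^+ (k.*2 + `|n|)%N / (k`! * (k + `|n|)`!)%N%:R) H.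
  move=> k; rewrite divr_ge0//=.
  have -> : (y / 2) ^+ (k.*2 + `|n|) = (y / 2) ^+ `|n| * ((y / 2) ^+ 2) ^+ k.
    by rewrite -exprM -exprD mul2n addnC.
  rewrite mulrA ler_wpM2l//; first by rewrite mulr_ge0// exprn_ge0.
  rewrite lef_pV2 ?posrE ?ltr0n ?muln_gt0 ?fact_gt0// ler_nat leq_pmulr//.
  exact: fact_gt0.
by rewrite /besselI (cvg_lim (@norm_hausdorff _ _) (nnsum_series Hs)).
Qed.

Lemma besselI_ge0 (n : int) (y : R) : 0 <= y -> 0 <= besselI n y.
Proof. by move=> y0; exact: nnsum_ge0 (nnsum_besselI n y0). Qed.

Definition pospart (d : int) : nat := if 0 <= d then `|d|%N else 0%N.
Definition negpart (d : int) : nat := if 0 <= d then 0%N else `|d|%N.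

(** The pairs of exponents [(k, j)] with [j - k = d] are enumerated by
    [min j k]: these are the terms whose sum is [I_d]. *)
Definition diagonal (p : int * nat) : nat * nat :=
  ((p.2 + negpart p.1)%N, (p.2 + pospart p.1)%N).

Lemma diagonal_bij : bijective diagonal.
Proof.
exists (fun p : nat * nat => (p.2%:Z - p.1%:Z, minn p.1 p.2)).
- move=> [d i]; rewrite /diagonal /pospart /negpart /=; congr pair; case: ifP; lia.
- by move=> [k j]; rewrite /diagonal /pospart /negpart /=; congr pair; case: ifP; lia.
Qed.

Lemma cexpi_int (d : int) (t : R) (P : R) (i : nat) :
  (P%:C * cexpi t) ^+ (i + pospart d) * (P%:C * cexpi (- t)) ^+ (i + negpart d) =
  (P ^+ (i.*2 + `|d|))%:C * cexpi (d%:~R * t).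
Proof.
have XC (n : nat) : P%:C ^+ n = (P ^+ n)%:C :> R[i] by rewrite rmorphXn.
rewrite !exprMn !XC -!cexpiMn mulrACA -rmorphM -exprD -cexpiD; congr ((P ^+ _)%:C * cexpi _).
  by rewrite /pospart /negpart; case: ifP; lia.
rewrite mulrN -mulrBl; congr (_ * _).
have -> : d = (i + pospart d)%:Z - (i + negpart d)%:Z.
  by rewrite /pospart /negpart; case: ifP; lia.
by rewrite intrB -!pmulrn; congr (_%:R - _%:R); rewrite /pospart /negpart; case: ifP; case: ifP; lia.
Qed.

Lemma fact_diagonal (d : int) (i : nat) :
  ((i + pospart d)`! * (i + negpart d)`! = i`! * (i + `|d|)`!)%N.
Proof. by rewrite /pospart /negpart; case: ifP => _; rewrite addn0// mulnC. Qed.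

Section GrafSeries.
Variables (m : int) (x y psi : R).
Hypotheses (y0 : 0 <= y) (yx : y < x).

Let p := (y / 2)%:C * cexpi psi.
Let q := (y / 2)%:C * cexpi (- psi).

Let pP : normc p = y / 2.
Proof. by rewrite Normc.normcM normc_cexpi mulr1 normc_real ger0_norm// divr_ge0. Qed.
Let qP : normc q = y / 2.
Proof. by rewrite Normc.normcM normc_cexpi mulr1 normc_real ger0_norm// divr_ge0. Qed.

Let term (kj : nat * nat) : R[i] :=
  p ^+ kj.2 / (kj.2)`!%:R * (q ^+ kj.1 / (kj.1)`!%:R) *
  (2 * besselK (m + kj.2%:Z - kj.1%:Z) x)%:C.

Let bessel_term (n : int) (k : nat) : R :=
  (y / 2) ^+ (k.*2 + `|n|)%N / (k`! * (k + `|n|)`!)%N%:R.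

Let K0 n : 0 <= 2 * besselK n x.
Proof. by rewrite mulr_ge0// ltW// besselK_gt0//; exact: le_lt_trans yx. Qed.

Let term_diagonal (d : int) (i : nat) :
  term (diagonal (d, i)) =
  (2 * besselK (m + d) x)%:C * cexpi (d%:~R * psi) * (bessel_term d i)%:C.
Proof.
rewrite /term /diagonal /=.
have -> : m + (i + pospart d)%:Z - (i + negpart d)%:Z = m + d.
  by rewrite /pospart /negpart; case: ifP; lia.
rewrite mulf_div cexpi_int -natrM fact_diagonal.
rewrite natC -fmorphV /bessel_term !rmorphM /=; ring.
Qed.

Let normc_term (d : int) (i : nat) :
  normc (term (diagonal (d, i))) = 2 * besselK (m + d) x * bessel_term d i.
Proof.
have b0 : 0 <= bessel_term d i by rewrite divr_ge0 ?exprn_ge0// divr_ge0.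
rewrite term_diagonal Normc.normcM normc_real (ger0_norm b0) Normc.normcM normc_cexpi.
by rewrite mulr1 normc_real ger0_norm.
Qed.

Let term_sums : nnsum (fun kj => normc (term kj)) (2 * besselK m (x - y)) /\
  has_sum term (cintegral mu (graf_kernel m x p q)).
Proof.
have [A HA1 HA2] := graf_abs m y0 yx pP qP.
have [B HB1 HB2] := graf_sum m y0 yx pP qP.
have e1 : nnsum (fun kj => normc (term kj)) (2 * besselK m (x - y)).
  have /= H := (nnsum_pair _ HA1).1 HA2.
  congr (nnsum _ _) : H; apply/funext => -[k j] /=.
  by rewrite /term /= [RHS]Normc.normcM normc_real ger0_norm.
split=> //; have [S HS] := has_sum_exists e1.
have HBS := has_sum_pair HS HB1.
by rewrite (has_sum_uniq HB2 HBS).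
Qed.

(** Along each diagonal the double series of [graf_abs] sums to a multiple of
    [I_d y]. *)
Lemma graf_nnsum : nnsum (fun d => besselI d y * besselK (m + d) x) (besselK m (x - y)).
Proof.
have H := nnsum_reindex diagonal_bij term_sums.1.
have HA (d : int) : nnsum (fun i => normc (term (diagonal (d, i))))
   (2 * besselK (m + d) x * besselI d y).
  have H' := nnsum_mul (K0 (m + d)) (nnsum_besselI d y0).
  by congr (nnsum _ _) : H'; apply/funext => i; rewrite normc_term.
have H2 : nnsum (fun d => 2 * besselK (m + d) x * besselI d y) (2 * besselK m (x - y)).
  apply/(nnsum_pair _ HA); congr (nnsum _ _) : H; by apply/funext => -[].
have h2 : 0 <= 2^-1 :> R by [].
have := nnsum_mul h2 H2; rewrite mulKf ?pnatr_eq0 // => {}H.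
by congr (nnsum _ _) : H; apply/funext => d; field.
Qed.

Lemma graf_has_sum_kernel : has_sum
  (fun d => (besselI d y * besselK (m + d) x)%:C * cexpi (d%:~R * psi))
  (2^-1 * cintegral mu (graf_kernel m x p q)).
Proof.
have H := has_sum_reindex diagonal_bij term_sums.2.
have HA (d : int) : has_sum (fun i => (term \o diagonal) (d, i))
   ((2 * besselK (m + d) x)%:C * cexpi (d%:~R * psi) * (besselI d y)%:C).
  have H1 := has_sumM ((2 * besselK (m + d) x)%:C * cexpi (d%:~R * psi))
    (has_sum_real (nnsum_rhas_sum (nnsum_besselI d y0))).
  by apply: eq_has_sum H1 => i; rewrite /= term_diagonal.
have H2 := has_sumM 2^-1 (has_sum_pair H HA).
apply: eq_has_sum H2 => d; rewrite !rmorphM /= (_ : 2%:C = 2); last by rewrite natC.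
by field.
Qed.

(** [x - y e^{i psi} = r e^{- i al}], so the integrand is the kernel of argument
    [r] on a line rotated by [al]. *)
Lemma graf_integral (r al : R) : 0 < r -> - (pi / 2) < al < pi / 2 ->
  x - y * cos psi = r * cos al -> y * sin psi = r * sin al ->
  cintegral mu (graf_kernel m x p q) = 2 * (besselK m r)%:C * cexpi (m%:~R * al).
Proof.
move=> r0 al2 hc hs.
have c0 : 0 < r * cos al by rewrite mulr_gt0// cos_gt0_pihalf.
pose ph t := r * sin al * sinh t - m%:~R * al.
have gE t : graf_kernel m x p q t =
    cexpi (m%:~R * al) * (kernel m%:~R (r * cos al) t)%:C * cexpi (ph t).
  rewrite /graf_kernel -mulrA -cexpD; set z := _ + _.
  have zR : Re z = y * cos psi * cosh t.
    by rewrite /z ReD /p /q !ReM !ImM /= cosN sinN /cosh; field.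
  have zI : Im z = m%:~R * al + ph t.
    by rewrite /z /ph -hs ImD /p /q !ImM !ReM /= cosN sinN /sinh; field.
  have -> : kernel m%:~R (r * cos al) t = kernel m%:~R x t * expR (Re z).
    by rewrite /kernel -expRD zR -hc; congr expR; ring.
  by rewrite /cexp zI cexpiD [in RHS]rmorphM /=; ring.
have ki (c : R -> R) : continuous c -> (forall t, `|c t| <= 1) ->
    mu.-integrable setT (EFin \o (fun t => kernel m%:~R (r * cos al) t * c t)).
  move=> cc c1; apply: le_integrable (integrable_kernel m%:~R c0) => //.
    apply: continuous_measurable_EFin => t; apply: cvgM; last exact: cc.
    exact: continuous_kernel.
  move=> t _ /=; rewrite lee_fin normrM ler_piMr//.
have phc : continuous ph by apply: deriv_continuous => t; rewrite /ph; eexists; deriv.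
have cc : continuous (fun t => cos (ph t)).
  by move=> t; apply: (continuous_comp (phc t)); exact: continuous_cos.
have sc : continuous (fun t => sin (ph t)).
  by move=> t; apply: (continuous_comp (phc t)); exact: continuous_sin.
have c_i := ki _ cc (fun t => cos_max _); have s_i := ki _ sc (fun t => sin_max _).
have Ic : \int[mu]_t (kernel m%:~R (r * cos al) t * cos (ph t)) = 2 * besselK m r.
  have := integral_kernel_rotate m%:~R 0 r0 al2; rewrite -besselKE//.
  under eq_Rintegral do rewrite subr0.
  by move=> ->; apply: eq_Rintegral => t _; rewrite cos0 mulr1.
have Is : \int[mu]_t (kernel m%:~R (r * cos al) t * sin (ph t)) = 0.
  have := integral_kernel_rotate m%:~R (pi / 2) r0 al2.
  under eq_Rintegral do rewrite cosB cos_pihalf sin_pihalf mulr0 add0r mulr1.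
  move=> ->; under eq_Rintegral do rewrite cos_pihalf mulr0.
  by rewrite Rintegral_cst// mul0r.
have twoC : (2 : R[i]) = 2%:C by rewrite natC.
have RI (f : R -> R[i]) : Re (cintegral mu f) = \int[mu]_t Re (f t) by [].
have II (f : R -> R[i]) : Im (cintegral mu f) = \int[mu]_t Im (f t) by [].
apply: complex_eq; rewrite ?RI ?II.
- transitivity (\int[mu]_t (cos (m%:~R * al) * (kernel m%:~R (r * cos al) t * cos (ph t)) -
     sin (m%:~R * al) * (kernel m%:~R (r * cos al) t * sin (ph t)))).
    apply: eq_Rintegral => t _; rewrite gE !ReM !ImM /=; ring.
  rewrite RintegralB//; last 2 first.
  + by have := integrableZl measurableT (cos (m%:~R * al)) c_i.
  + by have := integrableZl measurableT (sin (m%:~R * al)) s_i.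
  rewrite !RintegralZl// Ic Is twoC !ReM !ImM /=; ring.
- transitivity (\int[mu]_t (sin (m%:~R * al) * (kernel m%:~R (r * cos al) t * cos (ph t)) +
     cos (m%:~R * al) * (kernel m%:~R (r * cos al) t * sin (ph t)))).
    apply: eq_Rintegral => t _; rewrite gE !ImM !ReM /=; ring.
  rewrite RintegralD//; last 2 first.
  + by have := integrableZl measurableT (sin (m%:~R * al)) c_i.
  + by have := integrableZl measurableT (cos (m%:~R * al)) s_i.
  rewrite !RintegralZl// Ic Is twoC !ImM !ReM /=; ring.
Qed.

Lemma graf_has_sum (r al : R) : 0 < r -> - (pi / 2) < al < pi / 2 ->
  x - y * cos psi = r * cos al -> y * sin psi = r * sin al ->
  has_sum (fun d => (besselI d y * besselK (m + d) x)%:C * cexpi (d%:~R * psi))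
    ((besselK m r)%:C * cexpi (m%:~R * al)).
Proof.
move=> r0 al2 hc hs; have := graf_has_sum_kernel.
by rewrite (graf_integral r0 al2 hc hs) -[2 * _ * _]mulrA mulKf// pnatr_eq0.
Qed.

End GrafSeries.
End GrafTheorem.

(** * Binomial and logarithmic series *)
Section PowerSeries.
Variable R : realType.
Implicit Types (u : R[i]) (r : R).

(** Multiplication of a power series by its variable. *)
Definition delay (V : zmodType) (f : nat -> V) (n : nat) : V :=
  if n is k.+1 then f k else 0.

Lemma nnsum_delay (f : nat -> R) s : nnsum f s -> nnsum (delay f) s.
Proof.
move=> fs; apply: nnsum_cvg; first by case=> //= k; exact: fs.1.
rewrite -cvg_shiftS; apply: cvg_trans (nnsum_series fs); apply: near_eq_cvg.
by apply: nearW => n; rewrite /series /= [in RHS]big_nat_recl//= add0r.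
Qed.

Lemma rhas_sum_delay (f : nat -> R) s : rhas_sum f s -> rhas_sum (delay f) s.
Proof.
move=> [g [h [p [q [gp hq fE ->]]]]]; exists (delay g), (delay h), p, q; split => //.
- exact: nnsum_delay.
- exact: nnsum_delay.
- by case=> [|k] /=; rewrite ?subr0.
Qed.

Lemma has_sum_delay (f : nat -> R[i]) s : has_sum f s -> has_sum (delay f) s.
Proof.
move=> [f1 f2]; split.
- have := rhas_sum_delay f1; congr (rhas_sum _ _); by apply/funext => -[].
- have := rhas_sum_delay f2; congr (rhas_sum _ _); by apply/funext => -[].
Qed.

(** Pascal's rule: multiplication by [1 - r] lowers the order of the binomial
    series by one, up to the last term. *)
Lemma binomial_partial_sum (V : comNzRingType) (r : V) m N :
  (1 - r) * (\sum_(0 <= k < N.+1) 'C(m.+1 + k, k)%:R * r ^+ k) +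
    'C(m.+1 + N, N)%:R * r ^+ N.+1 = \sum_(0 <= k < N.+1) 'C(m + k, k)%:R * r ^+ k.
Proof.
elim: N => [|N IH]; first by rewrite !big_nat1 !addn0 !bin0 !expr0 expr1; ring.
rewrite big_nat_recr//= [RHS]big_nat_recr//= -IH.
have -> : 'C(m.+1 + N.+1, N.+1)%:R = 'C(m + N.+1, N.+1)%:R + 'C(m.+1 + N, N)%:R :> V.
  by rewrite addSn binS natrD addnS.
rewrite !exprS; ring.
Qed.

Lemma nnsum_binomial_exists r m : 0 <= r < 1 ->
  exists s, nnsum (fun k => 'C(m + k, k)%:R * r ^+ k) s.
Proof.
move=> /andP[r0 r1]; elim: m => [|m [s fs]].
  have rC : `|r| < 1 by rewrite ger0_norm.
  exists (1 - r)^-1; apply: nnsum_cvg; first by move=> n; rewrite mulr_ge0 ?exprn_ge0.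
  have := cvg_geometric_series (a := 1) rC; rewrite mul1r; apply: cvg_trans.
  apply: near_eq_cvg; apply: nearW => n; apply: eq_bigr => k _ /=.
  by rewrite add0n binn.
have f0 k : 0 <= 'C(m.+1 + k, k)%:R * r ^+ k by rewrite mulr_ge0 ?exprn_ge0.
apply: (nnsum_bounded (B := s / (1 - r))) => // n; have r10 : 0 < 1 - r by rewrite subr_gt0.
have inc : series (fun k => 'C(m.+1 + k, k)%:R * r ^+ k) n <=
    series (fun k => 'C(m.+1 + k, k)%:R * r ^+ k) n.+1.
  by rewrite /series /= big_nat_recr//= lerDl.
apply: le_trans inc _; rewrite ler_pdivlMr// mulrC.
have := binomial_partial_sum r m n.
have : series (fun k => 'C(m + k, k)%:R * r ^+ k) n.+1 <= s.
  rewrite -(cvg_lim (@norm_hausdorff _ _) (nnsum_series fs)).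
  apply: nondecreasing_cvgn_le.
    by apply: nondecreasing_series => k _ _; exact: fs.1.
  by apply/cvg_ex; exists s; exact: nnsum_series.
rewrite /series /= => h1 h2; apply: le_trans h1; rewrite -h2 lerDl.
by rewrite mulr_ge0 ?exprn_ge0.
Qed.

(** Absolute convergence comes from the real series at [|u|]; the value then
    follows by induction from [(1 - u) S_{n+1} = S_n]. *)
Lemma has_sum_binomial u m : normc u < 1 ->
  has_sum (fun k => 'C(m + k, k)%:R * u ^+ k) ((1 - u) ^- m.+1).
Proof.
move=> u1.
have u11 : 1 - u != 0.
  by apply/eqP => /subr0_eq u1E; move: u1; rewrite -u1E Normc.normc1 ltxx.
have ex n : exists s, has_sum (fun k => 'C(n + k, k)%:R * u ^+ k) s.
  have [|s fs] := @nnsum_binomial_exists (normc u) n; first by rewrite normc_ge0.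
  apply: (@has_sum_exists _ _ _ s); congr (nnsum _ _) : fs.
  by apply/funext => k; rewrite Normc.normcM normcX natC normc_real ger0_norm.
have stepE n s s' : has_sum (fun k => 'C(n.+1 + k, k)%:R * u ^+ k) s ->
    has_sum (fun k => 'C(n + k, k)%:R * u ^+ k) s' -> s' = (1 - u) * s.
  move=> fs fs'; apply: has_sum_uniq fs' _; rewrite mulrBl mul1r.
  apply: eq_has_sum (has_sumB fs (has_sum_delay (has_sumM u fs))) => -[|k] /=.
    by rewrite !addn0 !bin0 subr0.
  by rewrite [(n.+1 + k.+1)%N]addSn binS natrD [(n.+1 + k)%N]addSnnS exprS; ring.
elim: m => [|m IH].
  have [s fs] := ex 0%N; suff -> : (1 - u) ^- 1 = s by [].
  have fs0 : has_sum (fun k => if k == 0%N then 1 else 0) ((1 - u) * s).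
    rewrite mulrBl mul1r.
    apply: eq_has_sum (has_sumB fs (has_sum_delay (has_sumM u fs))) => -[|k] /=.
      by rewrite bin0 expr0 mulr1 subr0.
    by rewrite !add0n !binn !mul1r exprS subrr.
  have := has_sum_uniq fs0 (has_sum_delta 0%N 1).
  by move=> e; apply: (mulfI u11); rewrite e expr1 divff.
have [s fs] := ex m.+1; have e := stepE _ _ _ fs IH.
suff -> : (1 - u) ^- m.+2 = s by [].
by rewrite exprS invfM e mulKf.
Qed.

Lemma Re_geometric_quotient (psi tau : R) : `|tau| < 1 ->
  Re (cexpi psi * (1 - tau%:C * cexpi psi)^-1) =
  (cos psi - tau) / (1 - 2 * tau * cos psi + tau ^+ 2).
Proof.
move=> t1.
have cs := cos2Dsin2 psi.
have D0 : 0 < 1 - 2 * tau * cos psi + tau ^+ 2.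
  have c1 : cos psi ^+ 2 <= 1 by have := sqr_ge0 (sin psi); lra.
  have : `|tau * cos psi| <= `|tau| by rewrite normrM ler_piMr// cos_max.
  have := ler_norm (tau * cos psi).
  have : 0 < (1 - `|tau|) ^+ 2 by rewrite exprn_gt0// subr_gt0.
  rewrite -[tau ^+ 2]real_normK ?num_real//; nra.
set D := 1 - _ + _ in D0 *.
have Dn : D != 0 by rewrite gt_eqF.
have -> : (1 - tau%:C * cexpi psi)^-1 = (D^-1)%:C * (1 - tau%:C * cexpi (- psi)).
  have zz : (1 - tau%:C * cexpi psi) * (1 - tau%:C * cexpi (- psi)) = D%:C.
    apply: complex_eq; rewrite ?ReM ?ImM !ReD !ImD !ReN !ImN !ReM !ImM /= cosN sinN /D.
      rewrite (_ : tau ^+ 2 = tau ^+ 2 * (cos psi ^+ 2 + sin psi ^+ 2)); last by rewrite cs mulr1.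
      ring.
    ring.
  have z0 : 1 - tau%:C * cexpi psi != 0.
    apply/eqP => z0; move: zz; rewrite z0 mul0r => /(congr1 (@complex.Re R)) /= D00.
    by move: D0; rewrite -D00 ltxx.
  apply: (mulfI z0); rewrite divff// mulrCA zz -rmorphM /= mulVf//.
rewrite ReM !ImM !ReM !ReD !ImD !ReN !ImN !ReM !ImM /= cosN sinN.
rewrite (_ : cos psi - tau = cos psi - tau * (cos psi ^+ 2 + sin psi ^+ 2)); last by rewrite cs mulr1.
by field.
Qed.

(** Both sides have the derivative [Re (e^{i psi} / (1 - r e^{i psi}))] in [r] and
    vanish at [r = 0]; the right-hand side is [- ln |1 - r e^{i psi}|].  The term
    of index [0] is zero since [0^-1 = 0]. *)
Lemma rhas_sum_log (psi r : R) : 0 <= r < 1 ->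
  rhas_sum (fun k : nat => cos (k%:R * psi) / k%:R * r ^+ k)
    (- (ln (1 - 2 * r * cos psi + r ^+ 2) / 2)).
Proof.
move=> /andP[r0 r1].
pose c (k : nat) : R := cos (k%:R * psi) / k%:R.
have dc : pseries_diffs c = fun k : nat => cos (k.+1%:R * psi).
  apply/funext => k; rewrite /pseries_diffs /c mulrCA divff ?mulr1//.
have ddc : pseries_diffs (pseries_diffs c) = fun k : nat => k.+1%:R * cos (k.+2%:R * psi).
  by rewrite dc.
have bnd (b : nat -> R) (K : R) : (forall k, `|b k| <= k.+1%:R) -> 0 <= K < 1 ->
    exists s, rhas_sum (fun k => b k * K ^+ k) s.
  move=> hb K01; have [s fs] := nnsum_binomial_exists 1 K01.
  have [|s' fs'] := nnsum_le (f := fun k => `|b k * K ^+ k|) fs.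
    have /andP[K0 _] := K01; move=> k; rewrite normr_ge0/= normrM (ger0_norm (exprn_ge0 _ K0)).
    by rewrite ler_wpM2r ?exprn_ge0// add1n binSn.
  exact: rhas_sum_exists fs'.
have cb k : `|c k| <= k.+1%:R.
  rewrite /c normrM; apply: (@le_trans _ _ 1); last by rewrite ler1n.
  rewrite mulr_ile1// ?cos_max// ger0_norm ?invr_ge0//.
  by case: k => [|k]; [rewrite invr0|rewrite invf_le1 ?ler1n ?ltr0n].
have db k : `|pseries_diffs c k| <= k.+1%:R.
  by rewrite dc (le_trans (cos_max _))// ler1n.
have ddb k : `|pseries_diffs (pseries_diffs c) k| <= k.+1%:R.
  by rewrite ddc normrM ger0_norm// ler_piMr// cos_max.
have pcvg (b : nat -> R) (K : R) : (forall k, `|b k| <= k.+1%:R) -> 0 <= K < 1 -> cvgn (pseries b K).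
  move=> hb K01; have [s fs] := bnd b K hb K01.
  by apply/cvg_ex; exists s; exact: rhas_sum_series fs.
pose S t := limn (pseries c t).
have dS (t : R) : 0 <= t < 1 -> is_derive t 1 S ((cos psi - t) / (1 - 2 * t * cos psi + t ^+ 2)).
  move=> /andP[t0 t1].
  have K01 : 0 <= (t + 1) / 2 < 1 by lra.
  have -> : (cos psi - t) / (1 - 2 * t * cos psi + t ^+ 2) = limn (pseries (pseries_diffs c) t).
    apply/esym/cvg_lim => //; apply: rhas_sum_series.
    have t1' : `|t| < 1 by rewrite ger0_norm.
    rewrite -Re_geometric_quotient//.
    have u1 : normc (t%:C * cexpi psi) < 1 by rewrite Normc.normcM normc_cexpi mulr1 normc_real.
    have [H _] := has_sumM (cexpi psi) (has_sum_binomial 0 u1).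
    rewrite expr1 in H; congr (rhas_sum _ _) : H; apply/funext => k.
    rewrite add0n binn mul1r exprMn -cexpiMn -rmorphXn mulrCA -cexpiD dc ReM /= mul0r subr0 mulrC.
    by congr (cos _ * _); rewrite -nat1r; ring.
  apply: (@pseries_snd_diffs _ c ((t + 1) / 2)).
  - exact: pcvg.
  - exact: pcvg.
  - exact: pcvg.
  - by rewrite !ger0_norm; lra.
pose Dn t := 1 - 2 * t * cos psi + t ^+ 2.
have Dpos (t : R) : 0 <= t < 1 -> 0 < Dn t.
  move=> t01; have := cos_le1 psi; have : 0 < (1 - t) ^+ 2 by rewrite exprn_gt0//; lra.
  rewrite /Dn; nra.
have dL (t : R) : 0 <= t < 1 -> is_derive t 1 (fun t => S t + ln (Dn t) / 2) 0.
  move=> t01; have d1 := dS t t01.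
  have d2 : is_derive t 1 (fun t => ln (Dn t)) ((Dn t)^-1 * (2 * t - 2 * cos psi)).
    apply: deriv_comp; first exact/is_derive1_ln/Dpos.
    have dD (cp : R) : is_derive t 1 (fun t : R => 1 - 2 * t * cp + t ^+ 2) (2 * t - 2 * cp).
      have dE : is_derive t 1 (fun t : R => 1 - 2 * t * cp + t * t)
        (0 - ((0 * t + 2 * 1) * cp + 2 * t * 0) + (1 * t + t * 1)) by deriv.
      by apply: deriv_ext dE => [s|]; ring.
    exact: dD.
  have d3 := deriv_add d1 (deriv_mul d2 (deriv_cst t 2^-1)).
  apply: deriv_ext d3 => //; rewrite -/(Dn t).
  have := Dpos t t01 => D0; field; by rewrite gt_eqF.
have S0 : S 0 = 0.
  apply/cvg_lim => //; apply: cvg_near_cst; apply: nearW => n.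
  rewrite /pseries /series /= big1// => -[|k] _; first by rewrite /c invr0 mulr0 mul0r.
  by rewrite exprS mul0r mulr0.
have const : S r + ln (Dn r) / 2 = S 0 + ln (Dn 0) / 2.
  move: (r0); rewrite le_eqVlt => /orP[/eqP <-//|r0'].
  have [||t _] := @MVT _ (fun t => S t + ln (Dn t) / 2) (fun=> 0) 0 r r0'.
  - by move=> t; rewrite in_itv/= => /andP[t0 tr]; apply: dL; lra.
  - apply: derivable_within_continuous => t; rewrite in_itv/= => /andP[t0 tr].
    by have [] : is_derive t 1 (fun t => S t + ln (Dn t) / 2) 0 by apply: dL; lra.
  - by rewrite mul0r => /eqP; rewrite subr_eq0 => /eqP.
have D0 : Dn 0 = 1 by rewrite /Dn expr0n /=; ring.
rewrite S0 D0 ln1 mul0r addr0 in const.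
have -> : - (ln (1 - 2 * r * cos psi + r ^+ 2) / 2) = S r by rewrite -/(Dn r); lra.
have r01 : 0 <= r < 1 by rewrite r0.
have [s fs] := bnd c r cb r01.
by rewrite /S (cvg_lim (@norm_hausdorff _ _) (rhas_sum_series fs)).
Qed.

End PowerSeries.

(** * Translation of the singular parts *)
Section Laurent.
Variable R : realType.

Lemma has_sum_int_split (f : int -> R[i]) p q :
  has_sum (f \o Posz) p -> has_sum (f \o Negz) q -> has_sum f (p + q).
Proof.
have rsplit (h : int -> R) s t :
    rhas_sum (h \o Posz) s -> rhas_sum (h \o Negz) t -> rhas_sum h (s + t).
  move=> [g1 [h1 [p1 [q1 [gp1 hq1 fE1 ->]]]]] [g2 [h2 [p2 [q2 [gp2 hq2 fE2 ->]]]]].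
  pose join (u v : nat -> R) (m : int) := match m with Posz n => u n | Negz n => v n end.
  exists (join g1 g2), (join h1 h2), (p1 + p2), (q1 + q2); split.
  - exact: nnsum_int_split.
  - exact: nnsum_int_split.
  - by case=> n; [exact: fE1|exact: fE2].
  - by ring.
by move=> [f1 f2] [g1 g2]; split; rewrite ?ReD ?ImD; apply: rsplit.
Qed.

Lemma has_sum_conj (T : choiceType) (f : T -> R[i]) s : has_sum f s ->
  has_sum (fun t => (f t)^*%C) (s^*%C).
Proof.
have ReC (z : R[i]) : Re (z^*%C) = Re z by case: z.
have ImC (z : R[i]) : Im (z^*%C) = - Im z by case: z.
move=> [f1 f2]; split; rewrite ?ReC ?ImC.
- by under eq_fun do rewrite ReC.
- by under eq_fun do rewrite ImC; exact: rhas_sumN.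
Qed.

Variable lambda : R.
Hypothesis lambda0 : 0 < lambda.

Definition laurent (m : int) (r : R) : R :=
  if m == 0 then - ln r
  else 2 ^+ (`|m|%N.-1) * (`|m|%N.-1)`!%:R / (lambda ^+ `|m|%N * r ^+ `|m|%N).

Lemma QfunE m r : Qfun lambda m r = besselK m (lambda * r) - laurent m r.
Proof. by rewrite /Qfun /laurent; case: eqP => [->|//]; rewrite opprK. Qed.

Lemma laurentN m r : laurent (- m) r = laurent m r.
Proof. by rewrite /laurent oppr_eq0 abszN. Qed.

Lemma laurent_ge0 m r : m != 0 -> 0 <= r -> 0 <= laurent m r.
Proof.
move=> /negbTE m0 r0; rewrite /laurent m0.
by rewrite !(divr_ge0, mulr_ge0, exprn_ge0)// ltW.
Qed.

(** A pole of order [m] expands into poles of the same sign and of higher order;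
    the logarithm, [m = 0], into all orders. *)
Definition laurent_range (m d : int) : bool :=
  if m == 0 then true else if 0 < m then 0 <= d else d <= 0.

Definition laurent_term (rho rho0 psi : R) (m d : int) : R[i] :=
  if laurent_range m d then
    ((lambda * rho0 / 2) ^+ `|d|%N / `|d|%N`!%:R * laurent (m + d) rho)%:C * cexpi (d%:~R * psi)
  else 0.

Section Translate.
Variables (rho rho0 psi r al : R).
Hypotheses (rho00 : 0 <= rho0) (rho0_lt : rho0 < rho) (r0 : 0 < r).
Hypotheses (hc : rho - rho0 * cos psi = r * cos al) (hs : rho0 * sin psi = r * sin al).

Let rho_gt0 : 0 < rho. Proof. exact: le_lt_trans rho0_lt. Qed.
Let u : R[i] := (rho0 / rho)%:C * cexpi psi.

Let normc_u : normc u < 1.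
Proof.
have q0 : 0 <= rho0 / rho by apply: divr_ge0 => //; exact: ltW.
by rewrite Normc.normcM normc_cexpi mulr1 normc_real ger0_norm// ltr_pdivrMr// mul1r.
Qed.

Let one_sub_u : 1 - u = (r / rho)%:C * cexpi (- al).
Proof.
have rn : rho != 0 by rewrite gt_eqF.
apply: complex_eq; rewrite /u ?ReM ?ImM !(ReD, ImD, ReN, ImN, ReM, ImM) /= ?cosN ?sinN.
  rewrite [RHS](_ : _ = (r * cos al) / rho); last by ring.
  by rewrite -hc; field.
rewrite [RHS](_ : _ = - (r * sin al) / rho); last by ring.
by rewrite -hs; field.
Qed.

(** [r e^{- i al} = rho (1 - u)], so this is the binomial series of
    [(1 - u) ^- (n + 1)]. *)
Lemma laurent_translate_pos (n : nat) :
  has_sum (laurent_term rho rho0 psi n.+1) ((laurent n.+1 r)%:C * cexpi (n.+1%:R * al)).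
Proof.
have rn : rho != 0 by rewrite gt_eqF.
have rrn : r != 0 by rewrite gt_eqF.
have ln0 : lambda != 0 by rewrite gt_eqF.
pose c : R := 2 ^+ n * n`!%:R / (lambda * rho) ^+ n.+1.
have H := has_sumM c%:C (has_sum_binomial n normc_u).
have cE : c%:C * (1 - u) ^- n.+1 = (laurent n.+1 r)%:C * cexpi (n.+1%:R * al).
  rewrite one_sub_u exprMn -cexpiMn mulrN -rmorphXn invfM.
  have -> : (cexpi (- (n.+1%:R * al)))^-1 = cexpi (n.+1%:R * al).
    have e : cexpi (- (n.+1%:R * al)) * cexpi (n.+1%:R * al) = 1.
      by rewrite -cexpiD addNr cexpi0.
    have z : cexpi (- (n.+1%:R * al)) != 0.
      by apply/eqP => z; move: e; rewrite z mul0r => /eqP; rewrite eq_sym oner_eq0.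
    by apply: (mulfI z); rewrite e divff.
  rewrite mulrA -fmorphV -rmorphM; congr ((_)%:C * _).
  rewrite /c /laurent /= exprMn expr_div_n.
  move: (expf_neq0 n.+1 ln0) (expf_neq0 n.+1 rn) (expf_neq0 n.+1 rrn).
  move: (lambda ^+ n.+1) (rho ^+ n.+1) (r ^+ n.+1) => A B C A0 B0 C0.
  by field; rewrite C0 A0 B0.
have coefE k : c * ('C(n + k, k)%:R * (rho0 / rho) ^+ k) =
    (lambda * rho0 / 2) ^+ k / k`!%:R * laurent (n.+1%:Z + k%:Z) rho.
  rewrite /laurent /=.
  have kn : k`!%:R != 0 :> R by rewrite pnatr_eq0 -lt0n fact_gt0.
  have fE : ((n + k)`!%:R : R) = 'C(n + k, k)%:R * (k`!%:R * n`!%:R).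
    by rewrite -!natrM -(bin_fact (leq_addl n k)) addnK.
  rewrite addSn /= fE /c !exprMn !exprVn !exprS !exprD.
  by field; rewrite kn !expf_neq0// rn ln0.
rewrite cE in H; rewrite -[X in has_sum _ X]addr0; apply: has_sum_int_split; last first.
  by apply: eq_has_sum (@has_sum0 R nat) => k.
apply: eq_has_sum H => k.
have -> : (laurent_term rho rho0 psi n.+1 \o Posz) k =
  ((lambda * rho0 / 2) ^+ k / k`!%:R * laurent (n.+1%:Z + k%:Z) rho)%:C * cexpi (k%:R * psi).
  by [].
rewrite -coefE /u exprMn -cexpiMn -rmorphXn natC !rmorphM /=; ring.
Qed.

(** [r = rho |1 - u|], and [ln |1 - u|] is half the sum of the conjugate series
    [ln (1 - u)] and [ln (1 - u^* )], which carry the positive and the negative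
    orders. *)
Lemma laurent_translate_zero :
  has_sum (laurent_term rho rho0 psi 0) (laurent 0 r)%:C.
Proof.
have rn : rho != 0 by rewrite gt_eqF.
have ln0 : lambda != 0 by rewrite gt_eqF.
pose q := rho0 / rho.
have q0 : 0 <= q by apply: divr_ge0 => //; exact: ltW.
have q1 : q < 1 by rewrite ltr_pdivrMr// mul1r.
have q01 : 0 <= q < 1 by rewrite q0.
have coefE (k : nat) : (lambda * rho0 / 2) ^+ k.+1 / k.+1`!%:R * laurent k.+1%:Z rho =
    q ^+ k.+1 / k.+1%:R / 2.
  have kn : k`!%:R != 0 :> R by rewrite pnatr_eq0 -lt0n fact_gt0.
  have sn : k.+1%:R != 0 :> R by rewrite pnatr_eq0.
  rewrite /laurent /= factS natrM /q !exprMn !exprVn.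
  move: (expf_neq0 k.+1 ln0) (expf_neq0 k.+1 rn).
  rewrite (exprS 2 k); have := expf_neq0 k (_ : 2 != 0 :> R).
  move: (lambda ^+ k.+1) (rho ^+ k.+1) (rho0 ^+ k.+1) (2 ^+ k) => A B C D D0 A0 B0.
  move: (k.+1%:R : R) (k`!%:R : R) sn kn => E F E0 F0.
  by field; rewrite ?(A0, B0, D0, E0, F0).
pose g (k : nat) : R[i] := (q ^+ k / k%:R / 2)%:C * cexpi (k%:R * psi).
have [b gb] := nnsum_binomial_exists 0 q01.
have gle k : normc (g k) <= q ^+ k.
  rewrite Normc.normcM normc_cexpi mulr1 normc_real ger0_norm; last first.
    by rewrite !divr_ge0// exprn_ge0.
  have hk : (k%:R^-1 : R) <= 1 by case: k => [|k]; rewrite ?invr0// invf_le1 ?ler1n ?ltr0n.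
  have hk0 : 0 <= (k%:R^-1 : R) by rewrite invr_ge0.
  have := exprn_ge0 k q0; nra.
have bE k : 'C(0 + k, k)%:R * q ^+ k = q ^+ k by rewrite add0n binn mul1r.
have [s gs] : exists s, has_sum g s.
  have [|s fs] := nnsum_le (f := fun k => normc (g k)) gb.
    by move=> k; rewrite normc_ge0 bE gle.
  exact: has_sum_exists fs.
have [s' gs'] : exists s', has_sum (fun k => (g k.+1)^*%C) s'.
  have nconj (z : R[i]) : normc (z^*%C) = normc z by case: z => x y /=; rewrite sqrrN.
  have [|t fs] := nnsum_le (f := fun k => normc ((g k.+1)^*%C)) gb.
    move=> k; rewrite normc_ge0 bE nconj (le_trans (gle _))// exprS.
    by rewrite ler_piMl ?exprn_ge0// ltW.
  exact: has_sum_exists fs.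
have g0 : g 0%N = 0 by rewrite /g invr0 mulr0 !mul0r.
have s'E : s' = s^*%C.
  apply: has_sum_uniq (has_sum_conj gs); apply: eq_has_sum (has_sum_delay gs') => -[|k]; last by [].
  by rewrite g0 conjc0.
have ReS : Re s = - (ln (1 - 2 * q * cos psi + q ^+ 2) / 2) / 2.
  apply: rhas_sum_uniq gs.1 _; have := rhas_sumM 2^-1 (rhas_sum_log psi q01).
  rewrite mulrC; congr (rhas_sum _ _); apply/funext => k.
  by rewrite /g ReM /= mul0r subr0; ring.
have DE : 1 - 2 * q * cos psi + q ^+ 2 = (r / rho) ^+ 2.
  have c1 := cos2Dsin2 al; have c2 := cos2Dsin2 psi.
  have -> : (r / rho) ^+ 2 = ((r * cos al) ^+ 2 + (r * sin al) ^+ 2) / rho ^+ 2.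
    rewrite (_ : (r * cos al) ^+ 2 + _ = r ^+ 2 * (cos al ^+ 2 + sin al ^+ 2)); last by ring.
    by rewrite c1 mulr1 expr_div_n.
  rewrite -hc -hs.
  rewrite (_ : (rho - rho0 * cos psi) ^+ 2 + _ =
    rho ^+ 2 - 2 * rho * rho0 * cos psi + rho0 ^+ 2 * (cos psi ^+ 2 + sin psi ^+ 2)); last by ring.
  by rewrite c2 /q; field.
have lnE : ln ((r / rho) ^+ 2) = 2 * (ln r - ln rho).
  by rewrite lnXn ?divr_gt0// ln_div ?posrE// mulr_natl.
have -> : (laurent 0 r)%:C = ((- ln rho)%:C + s) + s'.
  rewrite s'E; apply: complex_eq; rewrite !(ReD, ImD) /laurent /=.
    by case: (s) ReS => x y /= ->; rewrite DE lnE; field.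
  by case: (s) => x y /=; ring.
apply: has_sum_int_split.
  apply: eq_has_sum (has_sumD (has_sum_delta 0%N (- ln rho)%:C) gs) => k.
  rewrite /laurent_term /laurent_range /comp eqxx add0r.
  case: k => [|k].
    rewrite eqxx g0 addr0 mul0r cexpi0 mulr1.
    by rewrite /laurent eqxx expr0 fact0 divr1 mul1r.
  by rewrite add0r coefE.
apply: eq_has_sum gs' => k.
rewrite /laurent_term /laurent_range /comp eqxx add0r NegzE laurentN abszN coefE.
rewrite mulrNz mulNr; apply: complex_eq; rewrite /g /cexpi /= cosN sinN; ring.
Qed.

End Translate.

(** Negative orders follow from positive ones by complex conjugation, that is by
    changing the signs of all angles. *)
Lemma laurent_translate (m : int) (rho rho0 psi r al : R) :
  0 <= rho0 -> rho0 < rho -> 0 < r ->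
  rho - rho0 * cos psi = r * cos al -> rho0 * sin psi = r * sin al ->
  has_sum (laurent_term rho rho0 psi m) ((laurent m r)%:C * cexpi (m%:~R * al)).
Proof.
move=> h0 h1 r0 hc hs; case: m => [[|n]|n].
- by rewrite mul0r cexpi0 mulr1; exact: laurent_translate_zero hc hs.
- exact: (laurent_translate_pos h0 h1 r0 hc hs n).
have hc' : rho - rho0 * cos (- psi) = r * cos (- al) by rewrite !cosN.
have hs' : rho0 * sin (- psi) = r * sin (- al) by rewrite !sinN !mulrN hs.
have H := laurent_translate_pos h0 h1 r0 hc' hs' n.
rewrite NegzE laurentN mulrNz mulNr -mulrN.
have bN : bijective (-%R : int -> int) by exists -%R; exact: opprK.
apply: eq_has_sum (has_sum_reindex bN H) => d.
rewrite /comp /laurent_term /laurent_range /= oppr_ge0 abszN mulrNz mulrNN.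
by rewrite [- n.+1%:Z + d]addrC -[d - _]opprB laurentN.
Qed.

(** At [psi = 0] the terms are their own moduli and [r = rho - rho0]. *)
Lemma laurent_translate_abs (m : int) (rho rho0 psi : R) : m != 0 ->
  0 <= rho0 -> rho0 < rho ->
  nnsum (fun d => normc (laurent_term rho rho0 psi m d)) (laurent m (rho - rho0)).
Proof.
move=> m0 h0 h1.
have r0 : 0 < rho - rho0 by rewrite subr_gt0.
have rho_ge0 : 0 <= rho by lra.
have hc : rho - rho0 * cos 0 = (rho - rho0) * cos 0 by rewrite cos0 !mulr1.
have hs : rho0 * sin 0 = (rho - rho0) * sin 0 by rewrite sin0 !mulr0.
have [H _] := laurent_translate m h0 h1 r0 hc hs.
have c0 d : laurent_range m d ->
    0 <= (lambda * rho0 / 2) ^+ `|d|%N / `|d|%N`!%:R * laurent (m + d) rho.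
  move=> md; apply: mulr_ge0.
    by rewrite divr_ge0// exprn_ge0// divr_ge0// mulr_ge0// ltW.
  apply: laurent_ge0 => //; move: md; rewrite /laurent_range (negbTE m0).
  by case: ifP => [?|/negbT]; move: m0; lia.
apply: rhas_sum_nnsum; first by move=> d; exact: normc_ge0.
rewrite mulr0 cexpi0 mulr1 in H; congr (rhas_sum _ _) : H; apply/funext => d.
rewrite /laurent_term; case: ifP => [md|_]; last by rewrite Normc.normc0.
by rewrite mulr0 cexpi0 mulr1 Normc.normcM normc_cexpi mulr1 normc_real ger0_norm ?c0.
Qed.

End Laurent.

(** * Separating the two kinds of coefficients *)
Section Separation.
Variable R : realType.
Local Notation mu := (@lebesgue_measure R).

Lemma besselKN (n : int) (x : R) : besselK (- n) x = besselK n x.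
Proof.
rewrite /besselK; apply: eq_Rintegral => t _.
by rewrite mulrNz mulNr coshN.
Qed.

Lemma besselK_abs (n : int) (x : R) : besselK `|n|%N x = besselK n x.
Proof. by case: n => n; rewrite ?NegzE ?abszN ?besselKN. Qed.

(** Uniformly in the order, the decrease of [z ^ |n| * K_n z] between two radii is
    not much smaller than the function itself further out.  After a shift of the
    variable by [ln (x2 / x1)] both terms of the difference are integrals with the
    same factor [x2 ^ |n|], and their integrands differ at least by
    [dl e^{- t}] times the kernel of argument [x2].  This exceeds a multiple of
    the kernel of argument [x], because [e^t] is bounded by a multiple of
    [e^{(x - x2) cosh t}]. *)
Lemma besselK_gap (x1 x2 x : R) : 0 < x1 -> x1 < x2 -> x2 < x ->
  exists2 C, 0 <= C & forall n : int,
    x2 ^+ `|n|%N * besselK n x <=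
    C * (x1 ^+ `|n|%N * besselK n x1 - x2 ^+ `|n|%N * besselK n x2).
Proof.
move=> x10 x12 x2x.
have x20 : 0 < x2 := lt_trans x10 x12.
have x0 : 0 < x := lt_trans x20 x2x.
have xx : 0 < x - x2 by rewrite subr_gt0.
have C1 : 0 <= 2 / (x - x2) by apply: divr_ge0; [exact: ler0n|exact: ltW].
have x1n : x1 != 0 by rewrite gt_eqF.
have x2n : x2 != 0 by rewrite gt_eqF.
pose x3 := x1 ^+ 2 / x2.
have x30 : 0 < x3 by rewrite divr_gt0// exprn_gt0.
have x32 : x3 < x2 by rewrite ltr_pdivrMr// -expr2 ltrXn2r// ?nnegrE; lra.
pose dl := (x2 - x3) / 2.
have dl0 : 0 < dl by rewrite divr_gt0// subr_gt0.
exists (2 / (x - x2) / dl); first by apply: divr_ge0; [exact: C1|exact: ltW].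
move=> n; rewrite -!(besselK_abs n); set l := `|n|%N.
pose h t := kernel l%:R x2 t * expR (dl * expR (- t)).
have lE (z : R) : 0 < z -> 2 * besselK l z = \int[mu]_t kernel l%:R z t.
  by move=> z0; rewrite -besselKE.
have shiftE : x1 ^+ l * (2 * besselK l x1) = x2 ^+ l * \int[mu]_t h t.
  rewrite lE// -(integral_kernel_shift _ (ln (x2 / x1)) x10).
  have q0 : 0 < x2 / x1 by rewrite divr_gt0.
  have kE t : kernel l%:R x1 (t + ln (x2 / x1)) = (x2 / x1) ^+ l * h t.
    rewrite -[X in X ^+ l]lnK ?posrE// -expRM_natl /h /kernel -!expRD; congr expR.
    rewrite /cosh opprD !expRD [expR (- ln _)]expRN !lnK ?posrE// invf_div /dl /x3.
    by field; rewrite x1n x2n.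
  under eq_Rintegral do rewrite kE.
  rewrite RintegralZl//; first by rewrite expr_div_n mulrA mulrCA divff ?expf_neq0// mulr1.
  apply: le_integrable (integrable_kernel l%:R x30) => //.
    apply: continuous_measurable_EFin; apply: deriv_continuous => t.
    by rewrite /h /kernel; eexists; deriv.
  move=> t _ /=; rewrite lee_fin !ger0_norm ?kernel_ge0//; last first.
    by apply: mulr_ge0; [exact: kernel_ge0|exact: expR_ge0].
  rewrite /h /kernel -expRD ler_expR /dl /cosh.
  have := expR_gt0 t; have := expR_gt0 (- t); nra.
have hi : mu.-integrable setT (EFin \o h).
  apply: le_integrable (integrable_kernel l%:R x30) => //.
    apply: continuous_measurable_EFin; apply: deriv_continuous => t.
    by rewrite /h /kernel; eexists; deriv.
  move=> t _ /=; rewrite lee_fin !ger0_norm ?kernel_ge0//; last first.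
    by apply: mulr_ge0; [exact: kernel_ge0|exact: expR_ge0].
  rewrite /h /kernel -expRD ler_expR /dl /cosh.
  have := expR_gt0 t; have := expR_gt0 (- t); nra.
have k1E t : kernel (l%:R - 1) x2 t = kernel l%:R x2 t * expR (- t).
  by rewrite /kernel -expRD; congr expR; ring.
have ki := integrable_kernel (l%:R - 1) x20.
have kl := integrable_kernel l%:R x20.
have gap : dl * \int[mu]_t kernel (l%:R - 1) x2 t <= \int[mu]_t h t - 2 * besselK l x2.
  rewrite lE// -RintegralB// -RintegralZl//; apply: le_Rintegral => //.
  - exact: (integrableZl measurableT dl ki).
  - exact: (integrableB measurableT hi kl).
  - move=> t _; rewrite k1E /h.
    have := expR_ge1Dx (dl * expR (- t)); have := kernel_ge0 l%:R x2 t; nra.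
have upper : 2 * besselK l x <= 2 / (x - x2) * \int[mu]_t kernel (l%:R - 1) x2 t.
  rewrite lE// -RintegralZl//; apply: le_Rintegral => //.
  - exact: integrable_kernel.
  - exact: (integrableZl measurableT (2 / (x - x2)) ki).
  - move=> t _; rewrite k1E.
    have -> : kernel l%:R x t = kernel l%:R x2 t * expR (- ((x - x2) * cosh t)).
      by rewrite /kernel -expRD; congr expR; ring.
    rewrite [leRHS]mulrCA; apply: ler_wpM2l; first exact: kernel_ge0.
    have et := expR_gt0 t.
    rewrite !expRN -[leLHS]mul1r ler_pdivrMr ?expR_gt0//.
    rewrite [leRHS](_ : _ = 2 * expR ((x - x2) * cosh t) / ((x - x2) * expR t)); last first.
      by field; rewrite !gt_eqF.
    have e1 : 1 + (x - x2) * cosh t <= expR ((x - x2) * cosh t) := expR_ge1Dx _.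
    have e2 := expR_le_cosh t.
    rewrite ler_pdivlMr ?mulr_gt0// mul1r.
    apply: (@le_trans _ _ (2 * ((x - x2) * cosh t))); first by rewrite mulrCA ler_pM2l.
    by rewrite ler_pM2l// (le_trans _ e1)// lerDr.
have x2l : 0 < x2 ^+ l by rewrite exprn_gt0.
rewrite -(ler_pM2l (ltr0n R 2)) mulrCA.
have -> : 2 * (2 / (x - x2) / dl * (x1 ^+ l * besselK l x1 - x2 ^+ l * besselK l x2)) =
  x2 ^+ l * (2 / (x - x2) * ((\int[mu]_t h t - 2 * besselK l x2) / dl)).
  have -> : x2 ^+ l * (2 / (x - x2) * ((\int[mu]_t h t - 2 * besselK l x2) / dl)) =
     2 / (x - x2) / dl * (x2 ^+ l * \int[mu]_t h t - x2 ^+ l * (2 * besselK l x2)) by ring.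
  by rewrite -shiftE; ring.
apply: ler_wpM2l; first exact: ltW.
apply: (le_trans upper); apply: ler_wpM2l; first exact: C1.
by rewrite ler_pdivlMr// mulrC.
Qed.

Variables (lambda : R) (a b : int -> R[i]) (rad : R).
Hypotheses (lambda0 : 0 < lambda) (rad0 : 0 < rad).
Hypothesis summable_terms : forall r, rad < r -> exists s,
  nnsum (fun m => normc (a m * (Qfun lambda m r)%:C + b m * (besselK m (lambda * r))%:C)) s.

Let normc_sub_le (p q : R) (z w : R[i]) : 0 <= p -> p <= q ->
  normc (p%:C * z - q%:C * w) <= q * (normc z + normc w).
Proof.
move=> p0 pq; rewrite (le_trans (le_normcD _ _))// normcN !Normc.normcM !normc_real.
rewrite (ger0_norm p0) (ger0_norm (le_trans p0 pq)) mulrDr lerD2r.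
by rewrite ler_wpM2r// normc_ge0.
Qed.

(** For two radii below [r], [r1 ^ |m| t1 - r2 ^ |m| t2] contains [a_m + b_m] only,
    where [t1], [t2] are the given terms at these radii.  At [m = 0], where
    [laurent] is a logarithm, the single term is added to the majorant. *)
Lemma separate_bessel r : rad < r ->
  exists s, nnsum (fun m => normc (a m + b m) * besselK m (lambda * r)) s.
Proof.
move=> radr; pose r1 := (2 * rad + r) / 3; pose r2 := (rad + 2 * r) / 3.
have h1 : rad < r1 by rewrite /r1; lra.
have h12 : r1 < r2 by rewrite /r1 /r2; lra.
have h2 : r2 < r by rewrite /r2; lra.
have r10 : 0 < r1 := lt_trans rad0 h1.
have r20 : 0 < r2 := lt_trans r10 h12.
have l1 : 0 < lambda * r1 by rewrite mulr_gt0.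
have l12 : lambda * r1 < lambda * r2 by rewrite ltr_pM2l.
have l2 : lambda * r2 < lambda * r by rewrite ltr_pM2l.
have [C C0 HC] := besselK_gap l1 l12 l2.
have [s1 H1] := summable_terms h1.
have [s2 H2] := summable_terms (lt_trans h1 h12).
pose c0 := normc (a 0 + b 0) * besselK 0 (lambda * r).
have Kge0 m z : rad < z -> 0 <= besselK m (lambda * z).
  by move=> hz; rewrite ltW// besselK_gt0// mulr_gt0// (lt_trans rad0).
have c00 : 0 <= c0 by rewrite mulr_ge0 ?normc_ge0// Kge0.
have H0 : nnsum (fun m : int => if m == 0 then c0 else 0) c0.
  apply: rhas_sum_nnsum; first by move=> m; case: ifP.
  have [H _] := has_sum_delta (0 : int) c0%:C.
  by congr (rhas_sum _ _) : H; apply/funext => m; case: ifP.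
have [|s Hs] := nnsum_le (f := fun m => normc (a m + b m) * besselK m (lambda * r))
   (nnsumD (nnsum_mul C0 (nnsumD H1 H2)) H0); last by exists s.
move=> m; rewrite mulr_ge0 ?normc_ge0 ?Kge0//=.
set t1 := _ + _ * (besselK m (lambda * r1))%:C.
set t2 := _ + _ * (besselK m (lambda * r2))%:C.
have [->|m0] := eqVneq m 0.
  by rewrite -/c0 lerDr mulr_ge0// addr_ge0 ?normc_ge0.
rewrite addr0; set l := `|m|%N; have := HC m; rewrite -/l => HCm.
have tE z : a m * (Qfun lambda m z)%:C + b m * (besselK m (lambda * z))%:C =
    (a m + b m) * (besselK m (lambda * z))%:C - a m * (laurent lambda m z)%:C.
  by rewrite QfunE rmorphB /=; ring.
have lauE z : 0 < z -> z ^+ l * laurent lambda m z =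
    2 ^+ l.-1 * (l.-1)`!%:R / lambda ^+ l.
  move=> z0; rewrite /laurent (negbTE m0) -/l.
  move: (expf_neq0 l (lt0r_neq0 z0)) (expf_neq0 l (lt0r_neq0 lambda0)).
  by move: (z ^+ l) (lambda ^+ l) => A B A0 B0; field; rewrite A0 B0.
have diffE : (r1 ^+ l)%:C * t1 - (r2 ^+ l)%:C * t2 =
    (a m + b m) * (r1 ^+ l * besselK m (lambda * r1) - r2 ^+ l * besselK m (lambda * r2))%:C.
  rewrite /t1 /t2 !tE.
  have e : (r1 ^+ l)%:C * (laurent lambda m r1)%:C = (r2 ^+ l)%:C * (laurent lambda m r2)%:C :> R[i].
    by rewrite -!rmorphM /= !lauE.
  have alg (f c A B k1 k2 L1 L2 : R[i]) : A * L1 = B * L2 ->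
      A * (f * k1 - c * L1) - B * (f * k2 - c * L2) = f * (A * k1 - B * k2).
    move=> AB; rewrite (_ : _ - _ = f * (A * k1 - B * k2) - c * (A * L1 - B * L2)).
      by rewrite AB subrr mulr0 subr0.
    ring.
  by rewrite (alg _ _ _ _ _ _ _ _ e) rmorphB !rmorphM.
have ll : 0 < lambda ^+ l by rewrite exprn_gt0.
have r2l : 0 < r2 ^+ l by rewrite exprn_gt0.
have r12l : r1 ^+ l <= r2 ^+ l.
  by apply: lerXn2r; rewrite ?nnegrE; [exact: ltW|exact: ltW|exact: ltW].
have gap : r2 ^+ l * besselK m (lambda * r) <=
    C * (r1 ^+ l * besselK m (lambda * r1) - r2 ^+ l * besselK m (lambda * r2)).
  have dist (A P1 P2 k1 k2 : R) :
      C * (A * P1 * k1 - A * P2 * k2) = A * (C * (P1 * k1 - P2 * k2)) by ring.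
  by rewrite -(ler_pM2l ll) mulrA -dist -!exprMn.
rewrite -(ler_pM2l r2l).
apply: (@le_trans _ _ (C * normc ((r1 ^+ l)%:C * t1 - (r2 ^+ l)%:C * t2))).
  rewrite diffE Normc.normcM normc_real mulrCA [leRHS]mulrCA ler_wpM2l ?normc_ge0//.
  by rewrite (le_trans gap)// ler_wpM2l// ler_norm.
rewrite [leRHS]mulrCA; apply: ler_wpM2l => //.
by apply: normc_sub_le; [apply: exprn_ge0; exact: ltW|exact: r12l].
Qed.

Lemma separate_laurent r : rad < r ->
  exists s, nnsum (fun m => normc (a m) * `|laurent lambda m r|) s.
Proof.
move=> radr; have [s1 H1] := separate_bessel radr; have [s2 H2] := summable_terms radr.
have [|s Hs] := nnsum_le (f := fun m => normc (a m) * `|laurent lambda m r|)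
   (nnsumD H1 H2); last by exists s.
move=> m; rewrite mulr_ge0 ?normc_ge0//=.
have K0 : 0 <= besselK m (lambda * r) by rewrite ltW// besselK_gt0// mulr_gt0// (lt_trans rad0).
have -> : normc (a m) * `|laurent lambda m r| = normc (a m * (laurent lambda m r)%:C).
  by rewrite Normc.normcM normc_real.
rewrite [X in normc X <= _](_ : _ = (a m + b m) * (besselK m (lambda * r))%:C -
   (a m * (Qfun lambda m r)%:C + b m * (besselK m (lambda * r))%:C)); last first.
  by rewrite QfunE rmorphB /=; ring.
by rewrite (le_trans (le_normcD _ _))// normcN lerD2r Normc.normcM normc_real ger0_norm.
Qed.

End Separation.

(** * The translated expansion *)
Section Translation.
Variable R : realType.

Lemma cexpi_neq0 (t : R) : cexpi t != 0.
Proof.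
apply/eqP => z; have := normc_cexpi t; rewrite z Normc.normc0 => /eqP.
by rewrite eq_sym oner_eq0.
Qed.



Lemma subz_bij (m : int) : bijective (fun l : int => l - m).
Proof. by exists (fun d => d + m) => d; rewrite ?subrK ?addrK. Qed.

Lemma zsum1 (p : int) (f : int -> R[i]) : zsum p p f = f p.
Proof. by rewrite /zsum subrr big_nat1 addr0. Qed.

(** The rotation of the contour needs an angle in the open right half plane, so
    the polar angle of the field point is chosen by [atan]. *)
Lemma polar_half_plane (p q : R) : 0 < p ->
  exists r al, [/\ 0 < r, - (pi / 2) < al < pi / 2, p = r * cos al & q = r * sin al].
Proof.
move=> p0; pose al := atan (q / p).
have al2 : - (pi / 2) < al < pi / 2 by rewrite atan_gtNpi2 atan_ltpi2.
have c0 : 0 < cos al by exact: cos_gt0_pihalf.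
exists (p / cos al), al; split => //; first exact: divr_gt0.
  by rewrite divfK// gt_eqF.
have : tan al = q / p by exact: atanK.
rewrite /tan => tE.
have -> : sin al = q / p * cos al by rewrite -tE divfK// gt_eqF.
by field; rewrite !gt_eqF.
Qed.

Lemma is_multipole_sum_has_sum (lambda : R) a b rho theta s :
  has_sum (multipole_term lambda a b rho theta) s ->
  is_multipole_sum lambda a b rho theta s.
Proof.
move=> H; split; first exact: (@has_sum_csummable _ xpredT _ s).
by rewrite (@has_sum_csum _ xpredT _ s).
Qed.

Variables (lambda rad : R) (x0 : R * R) (rho0 theta0 : R) (a b : int -> R[i]).
Variable phi : R * R -> R[i].
Hypotheses (lambda0 : 0 < lambda) (rad0 : 0 < rad).
Hypothesis polar0 : polar_coords x0 (0, 0) rho0 theta0.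
Hypothesis phi_sum : forall x rho theta, polar_coords x x0 rho theta -> rad < rho ->
  is_multipole_sum lambda a b rho theta (phi x).

Let rho00 : 0 <= rho0. Proof. by case: polar0. Qed.
Let y0 : 0 <= lambda * rho0. Proof. by rewrite mulr_ge0// ltW. Qed.

Let terms_summable r : rad < r -> exists s,
  nnsum (fun m => normc (a m * (Qfun lambda m r)%:C + b m * (besselK m (lambda * r))%:C)) s.
Proof.
move=> radr; have r0 : 0 <= r by rewrite ltW// (lt_trans rad0).
have pc : polar_coords (x0 + (r * cos 0, r * sin 0)) x0 r 0.
  by split => //; rewrite addrC addKr.
have [/csummableP[s Hs] _] := phi_sum pc radr; exists s.
congr (nnsum _ _) : Hs; apply/funext => m.
by rewrite /multipole_term Normc.normcM normc_cexpi mulr1.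
Qed.

Section Point.
Variables (rho theta : R).
Hypothesis far : rad + rho0 < rho.

Let rho_gap : rad < rho - rho0. Proof. by rewrite ltrBrDr. Qed.
Let rho0_lt : rho0 < rho. Proof. by apply: lt_trans far; rewrite ltrDr. Qed.
Local Notation psi := (theta - theta0).

Let K_gt0 m r : rad < r -> 0 < besselK m (lambda * r).
Proof. by move=> h; rewrite besselK_gt0// mulr_gt0// (lt_trans rad0). Qed.

(** The contribution of the [m]-th given multipole to the [l]-th new one: its part
    that is a multiple of [K_l], and (next) its part that is a multiple of
    [laurent l]. *)
Definition bessel_pair (m l : int) : R[i] :=
  (a m + b m) * ((besselI (l - m) (lambda * rho0) * besselK l (lambda * rho))%:C *
    cexpi ((l - m)%:~R * psi)) * cexpi (m%:~R * theta).

Definition laurent_pair (m l : int) : R[i] :=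
  a m * laurent_term lambda rho rho0 psi m (l - m) * cexpi (m%:~R * theta).

Let subzK (m l : int) : m + (l - m) = l. Proof. by rewrite addrC subrK. Qed.

Let phaseE (m l : int) :
  cexpi ((l - m)%:~R * psi) * cexpi (m%:~R * theta) =
  cexpi (- ((l - m)%:~R * theta0)) * cexpi (l%:~R * theta).
Proof. by rewrite -!cexpiD; congr cexpi; rewrite intrB; ring. Qed.

Let rad_rho : rad < rho. Proof. by apply: le_lt_trans far; rewrite lerDl. Qed.

Lemma bessel_pairE m l : bessel_pair m l =
  trans_d_outer lambda a b rho0 theta0 l m *
  ((besselK l (lambda * rho))%:C * cexpi (l%:~R * theta)).
Proof.
rewrite /bessel_pair mulrA -mulrA phaseE /trans_d_outer rmorphM; ring.
Qed.

Let bessel_pair_abs m : nnsum (fun l => normc (bessel_pair m l)) (normc (a m + b m) * besselK m (lambda * (rho - rho0))).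
Proof.
have yx : lambda * rho0 < lambda * rho by rewrite ltr_pM2l.
have := nnsum_mul (normc_ge0 (a m + b m))
  (nnsum_reindex (subz_bij m) (graf_nnsum m psi y0 yx)).
rewrite -mulrBr => H1; congr (nnsum _ _) : H1; apply/funext => l /=.
rewrite /bessel_pair !Normc.normcM !normc_cexpi !mulr1 normc_real subzK ger0_norm//.
by rewrite mulr_ge0 ?besselI_ge0// ltW// K_gt0.
Qed.

Section Image.
Variables (r al : R).
Hypotheses (r0 : 0 < r) (al2 : - (pi / 2) < al < pi / 2).
Hypotheses (hc : rho - rho0 * cos psi = r * cos al) (hs : rho0 * sin psi = r * sin al).

Let bessel_pair_sum m : has_sum (bessel_pair m)
  ((a m + b m) * (besselK m (lambda * r))%:C * cexpi (m%:~R * (theta + al))).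
Proof.
have yx : lambda * rho0 < lambda * rho by rewrite ltr_pM2l.
have hc' : lambda * rho - lambda * rho0 * cos psi = lambda * r * cos al.
  by rewrite -!mulrA -hc; ring.
have hs' : lambda * rho0 * sin psi = lambda * r * sin al by rewrite -!mulrA hs.
have H1 := graf_has_sum m y0 yx (mulr_gt0 lambda0 r0) al2 hc' hs'.
have H2 := has_sumM ((a m + b m) * cexpi (m%:~R * theta)) (has_sum_reindex (subz_bij m) H1).
rewrite mulrDr cexpiD; have -> : (a m + b m) * (besselK m (lambda * r))%:C *
    (cexpi (m%:~R * theta) * cexpi (m%:~R * al)) =
  (a m + b m) * cexpi (m%:~R * theta) * ((besselK m (lambda * r))%:C * cexpi (m%:~R * al)) by ring.
by apply: eq_has_sum H2 => l; rewrite /= subzK /bessel_pair; ring.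
Qed.

Let laurent_pair_sum m : has_sum (laurent_pair m)
  (a m * (laurent lambda m r)%:C * cexpi (m%:~R * (theta + al))).
Proof.
have H1 := laurent_translate lambda0 m rho00 rho0_lt r0 hc hs.
have H2 := has_sumM (a m * cexpi (m%:~R * theta)) (has_sum_reindex (subz_bij m) H1).
rewrite mulrDr cexpiD; have -> : a m * (laurent lambda m r)%:C *
    (cexpi (m%:~R * theta) * cexpi (m%:~R * al)) =
  a m * cexpi (m%:~R * theta) * ((laurent lambda m r)%:C * cexpi (m%:~R * al)) by ring.
by apply: eq_has_sum H2 => l; rewrite /= /laurent_pair; ring.
Qed.

Let laurent_pair_abs : exists2 A : int -> R, forall m, nnsum (fun l => normc (laurent_pair m l)) (A m) &
  exists s, nnsum A s.
Proof.
have normH m l : normc (laurent_pair m l) = normc (a m) * normc (laurent_term lambda rho rho0 psi m (l - m)).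
  by rewrite /laurent_pair !Normc.normcM normc_cexpi mulr1.
have [s0 Hs0] := has_sum_abs (laurent_pair_sum 0).
pose A m := if m == 0 then s0 else normc (a m) * laurent lambda m (rho - rho0).
exists A => [m|].
  rewrite /A; case: eqP => [->//|/eqP m0].
  have := nnsum_mul (normc_ge0 (a m)) (nnsum_reindex (subz_bij m)
    (laurent_translate_abs lambda0 psi m0 rho00 rho0_lt)).
  by move=> H1; congr (nnsum _ _) : H1; apply/funext => l /=; rewrite normH.
have [s Hs] := separate_laurent lambda0 rad0 terms_summable rho_gap.
have s00 := nnsum_ge0 Hs0.
have D0 : nnsum (fun m : int => if m == 0 then s0 else 0) s0.
  apply: rhas_sum_nnsum; first by move=> m; case: ifP.
  have [D _] := has_sum_delta (0 : int) s0%:C.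
  by congr (rhas_sum _ _) : D; apply/funext => m; case: ifP.
have r1 : 0 <= rho - rho0 by rewrite ltW// (lt_trans rad0).
have [|t Ht] := nnsum_le (f := A) (nnsumD Hs D0); last by exists t.
move=> m; rewrite /A; case: eqP => [->|/eqP m0].
  by rewrite s00 lerDr mulr_ge0 ?normc_ge0.
have L0 := laurent_ge0 lambda0 m0 r1.
by rewrite addr0 ger0_norm// lexx andbT mulr_ge0 ?normc_ge0.
Qed.

Lemma translated_sums : exists C C' : int -> R[i], exists S S' : R[i],
  [/\ forall l, has_sum (bessel_pair ^~ l) (C l) /\ has_sum (laurent_pair ^~ l) (C' l),
      has_sum C S, has_sum C' S' &
      has_sum (multipole_term lambda a b r (theta + al)) (S - S')].
Proof.
have [s Hs] := separate_bessel lambda0 rad0 terms_summable rho_gap.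
have [C CG [S GS CS]] := has_sum_exchange bessel_pair_abs Hs bessel_pair_sum.
have [A HA [t Ht]] := laurent_pair_abs.
have [C' CH [S' HS CS']] := has_sum_exchange HA Ht laurent_pair_sum.
exists C, C', S, S'; split => //.
apply: eq_has_sum (has_sumB GS HS) => m.
by rewrite /multipole_term QfunE rmorphB; ring.
Qed.

End Image.

Lemma exists_image : exists r al, [/\ 0 < r, - (pi / 2) < al < pi / 2,
  rho - rho0 * cos psi = r * cos al & rho0 * sin psi = r * sin al].
Proof.
apply: polar_half_plane; have := cos_le1 psi; have := rho00; have := rho0_lt; nra.
Qed.

(** A column of [bessel_pair], divided by the nonzero factor
    [K_l (lambda rho) e^{i l theta}]. *)
Lemma outer_has_sum l : exists E, has_sum (trans_d_outer lambda a b rho0 theta0 l) E.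
Proof.
have [r [al [r0 al2 hc hs]]] := exists_image.
have [C [_ [_ [_ [/(_ l)[CG _] _ _ _]]]]] := translated_sums r0 al2 hc hs.
pose k := (besselK l (lambda * rho))%:C * cexpi (l%:~R * theta).
have k0 : k != 0.
  rewrite mulf_neq0// ?cexpi_neq0//; apply/eqP => /(congr1 (@complex.Re R)) /= /eqP.
  by rewrite gt_eqF// K_gt0.
exists (k^-1 * C l); apply: eq_has_sum (has_sumM k^-1 CG) => m.
by rewrite bessel_pairE -/k mulrCA mulVf// mulr1.
Qed.

Let laurent_range_row (l m : int) : laurent_range m (l - m) =
  (if l == 0 then m == 0 else if 0 < l then 0 <= m <= l else l <= m <= 0).
Proof.
rewrite /laurent_range; case: (ltrgtP l 0); case: (ltrgtP m 0) => //=; lia.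
Qed.

Let laurent_pairE (l m : int) : laurent_range m (l - m) ->
  laurent_pair m l = trans_c_term lambda a rho0 theta0 l m * ((laurent lambda l rho)%:C * cexpi (l%:~R * theta)).
Proof.
move=> lm; rewrite /laurent_pair /laurent_term lm subzK /trans_c_term mulrA -mulrA phaseE.
rewrite !rmorphM natC -fmorphV; ring.
Qed.

Lemma trans_c_has_sum l : has_sum (laurent_pair ^~ l)
  (trans_c lambda a rho0 theta0 l * ((laurent lambda l rho)%:C * cexpi (l%:~R * theta))).
Proof.
have HE0 m : ~~ laurent_range m (l - m) -> laurent_pair m l = 0.
  by move=> /negbTE lm; rewrite /laurent_pair /laurent_term lm mulr0 mul0r.
have main p q : p <= q -> (forall m, laurent_range m (l - m) = (p <= m <= q)) ->
    has_sum (laurent_pair ^~ l) (zsum p q (trans_c_term lambda a rho0 theta0 l) *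
      ((laurent lambda l rho)%:C * cexpi (l%:~R * theta))).
  move=> pq rE; rewrite mulrC.
  apply: eq_has_sum (has_sumM _ (has_sum_zsum (trans_c_term lambda a rho0 theta0 l) pq)) => m.
  rewrite -rE; case: ifPn => lm; last by rewrite HE0// mulr0.
  by rewrite laurent_pairE// mulrC.
have [l0|l0|l0] := ltrgtP l 0.
- rewrite /trans_c lt_eqF// ltNge (ltW l0) /=.
  by apply: main; [exact: ltW|move=> m; rewrite laurent_range_row lt_eqF// ltNge (ltW l0)].
- rewrite /trans_c gt_eqF// l0.
  by apply: main; [exact: ltW|move=> m; rewrite laurent_range_row gt_eqF// l0].
- rewrite l0 /trans_c eqxx.
  have -> : a 0 = zsum 0 0 (trans_c_term lambda a rho0 theta0 0).
    by rewrite zsum1 /trans_c_term subrr mulr0z mul0r oppr0 cexpi0 expr0 fact0 divr1 !mulr1.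
  rewrite -{1}l0; have := main 0 0 (lexx 0); rewrite l0; apply.
  by move=> m; rewrite -{1}l0 laurent_range_row l0 eqxx; lia.
Qed.

End Point.

Let far_exists : exists rho, rad + rho0 < rho.
Proof. by exists (rad + rho0 + 1); rewrite ltrDl. Qed.

Let outer_summable l : exists E, has_sum (trans_d_outer lambda a b rho0 theta0 l) E.
Proof. by have [rho far] := far_exists; exact: (outer_has_sum 0 far). Qed.

Let outer_mask l (D : pred int) : exists s,
  has_sum (fun m => if D m then trans_d_outer lambda a b rho0 theta0 l m else 0) s.
Proof.
have [E /has_sum_abs[s Hs]] := outer_summable l.
have [|s' Hs'] := nnsum_le (f := fun m =>
    normc (if D m then trans_d_outer lambda a b rho0 theta0 l m else 0)) Hs.
  by move=> m; rewrite normc_ge0/=; case: ifP; rewrite ?lexx// Normc.normc0 normc_ge0.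
exact: has_sum_exists Hs'.
Qed.

Let outer0E : trans_d0_outer lambda a b rho0 theta0 = trans_d_outer lambda a b rho0 theta0 0.
Proof.
by apply/funext => m; rewrite /trans_d0_outer /trans_d_outer sub0r mulrNz mulNr opprK.
Qed.

Lemma translated_d_summable l : trans_d_summable lambda a b rho0 theta0 l.
Proof.
have ok l' D : csummable D (trans_d_outer lambda a b rho0 theta0 l').
  by have [s] := outer_mask l' D; exact: has_sum_csummable.
by rewrite /trans_d_summable outer0E; case: ifP => _; [|case: ifP => _]; split; exact: ok.
Qed.

(** [trans_d] cuts the sum over all [m] at the ends of the range on which
    [trans_c] is a sum. *)
Let outer_split l (p q : int) (D1 D2 : pred int) : p <= q ->
  (forall m, D1 m = (m < p)) -> (forall m, D2 m = (q < m)) ->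
  has_sum (trans_d_outer lambda a b rho0 theta0 l)
    (csum D1 (trans_d_outer lambda a b rho0 theta0 l) +
     zsum p q (trans_d_outer lambda a b rho0 theta0 l) +
     csum D2 (trans_d_outer lambda a b rho0 theta0 l)).
Proof.
move=> pq d1 d2; have [s1 H1] := outer_mask l D1; have [s2 H2] := outer_mask l D2.
rewrite (has_sum_csum H1) (has_sum_csum H2).
have Hz := has_sum_zsum (trans_d_outer lambda a b rho0 theta0 l) pq.
apply: eq_has_sum (has_sumD (has_sumD H1 Hz) H2) => m.
rewrite d1 d2; case: (ltP m p) => mp; case: (ltP q m) => qm /=; rewrite ?addr0 ?add0r//.
by move: (lt_trans (lt_le_trans mp pq) qm); rewrite ltxx.
Qed.

Let innerE l m : trans_d_inner lambda a b rho0 theta0 l m + trans_c_term lambda a rho0 theta0 l m =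
  trans_d_outer lambda a b rho0 theta0 l m.
Proof.
rewrite /trans_d_inner /trans_c_term /trans_d_outer /Pfun rmorphB rmorphM fmorphV natC; ring.
Qed.

Let zsum_inner p q l : zsum p q (trans_d_inner lambda a b rho0 theta0 l) +
   zsum p q (trans_c_term lambda a rho0 theta0 l) =
   zsum p q (trans_d_outer lambda a b rho0 theta0 l).
Proof.
by rewrite /zsum -big_split /=; apply: eq_bigr => k _; exact: innerE.
Qed.

Lemma trans_dc_has_sum l : has_sum (trans_d_outer lambda a b rho0 theta0 l)
  (trans_d lambda a b rho0 theta0 l + trans_c lambda a rho0 theta0 l).
Proof.
have lez (m k : int) : (m <= k - 1) = (m < k) by lia.
have lez' (m k : int) : (k + 1 <= m) = (k < m) by lia.
rewrite /trans_d /trans_c; have [l0|l0|->] := ltrgtP l 0.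
- rewrite addrAC -[_ + _ + zsum _ _ _]addrA zsum_inner.
  by apply: outer_split => //; exact: ltW.
- rewrite addrAC -[_ + _ + zsum _ _ _]addrA zsum_inner.
  by apply: outer_split => //; exact: ltW.
- rewrite outer0E.
  have := @outer_split 0 0 0 (fun m => m <= -1) (fun m => 1 <= m) (lexx _)
    (fun m => lez m 0) (fun m => lez' m 0).
  have c0 : trans_c_term lambda a rho0 theta0 0 0 = a 0.
    by rewrite /trans_c_term subrr mulr0z mul0r oppr0 cexpi0 expr0 fact0 divr1 !mulr1.
  have i0 : trans_d_inner lambda a b rho0 theta0 0 0 =
      a 0 * (Pfun lambda 0 rho0)%:C + b 0 * (besselI 0 (lambda * rho0))%:C.
    by rewrite /trans_d_inner subrr mulr0z mul0r oppr0 cexpi0 mulr1.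
  rewrite zsum1 -innerE c0 i0; congr has_sum; ring.
Qed.

Lemma translated_multipole_sum x rho theta : polar_coords x (0, 0) rho theta ->
  rad + rho0 < rho ->
  is_multipole_sum lambda (trans_c lambda a rho0 theta0)
    (trans_d lambda a b rho0 theta0) rho theta (phi x).
Proof.
move=> [_ xE] far.
have [r [al [r0 al2 hc hs]]] := exists_image theta far.
have [C [C' [S [S' [CC CS CS' MS]]]]] := translated_sums far r0 al2 hc hs.
have radr : rad < r.
  have h1 : r * cos al <= r by rewrite ler_piMr ?cos_le1// ltW.
  have h2 : rho0 * cos (theta - theta0) <= rho0 by rewrite ler_piMr ?cos_le1.
  move: hc far; rewrite /=; lra.
have px : polar_coords x x0 r (theta + al).
  split; first exact: ltW.
  have [_ x0E] := polar0; rewrite !subr0 in xE x0E; rewrite xE x0E.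
  have c0 : cos theta0 = cos theta * cos (theta - theta0) + sin theta * sin (theta - theta0).
    by rewrite -cosB; congr cos; ring.
  have s0 : sin theta0 = sin theta * cos (theta - theta0) - cos theta * sin (theta - theta0).
    by rewrite -sinB; congr sin; ring.
  have e1 : r * cos (theta + al) = rho * cos theta - rho0 * cos theta0.
    rewrite cosD (_ : r * _ = cos theta * (r * cos al) - sin theta * (r * sin al)); last by ring.
    by rewrite -hc -hs c0; ring.
  have e2 : r * sin (theta + al) = rho * sin theta - rho0 * sin theta0.
    rewrite sinD (_ : r * _ = sin theta * (r * cos al) + cos theta * (r * sin al)); last by ring.
    by rewrite -hc -hs s0; ring.
  by rewrite e1 e2.
have [_ phiE] := phi_sum px radr.
have -> : phi x = S - S' by rewrite phiE; exact: has_sum_csum.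
apply: is_multipole_sum_has_sum; apply: eq_has_sum (has_sumB CS CS') => l.
have [CG CH] := CC l.
have K0 : besselK l (lambda * rho) > 0.
  by rewrite besselK_gt0// mulr_gt0// (lt_trans rad0)// (le_lt_trans _ far)// lerDl.
have e1 : C l = (trans_d lambda a b rho0 theta0 l + trans_c lambda a rho0 theta0 l) *
    ((besselK l (lambda * rho))%:C * cexpi (l%:~R * theta)).
  rewrite mulrC; apply: has_sum_uniq CG _.
  by apply: eq_has_sum (has_sumM _ (trans_dc_has_sum l)) => m; rewrite bessel_pairE mulrC.
rewrite e1 (has_sum_uniq CH (trans_c_has_sum _ far l)) /multipole_term QfunE rmorphB; ring.
Qed.

End Translation.

Theorem lemma7 (R : realType) (lambda rad : R) (x0 : R * R) (rho0 theta0 : R)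
    (a b : int -> R[i]) (phi : R * R -> R[i])
    (hlambda : 0 < lambda) (hrad : 0 < rad)
    (hx0 : polar_coords x0 (0, 0) rho0 theta0)
    (hphi : is_multipole_expansion lambda x0 rad a b phi) :
  (forall l : int, trans_d_summable lambda a b rho0 theta0 l) /\
  forall (x : R * R) (rho theta : R),
    polar_coords x (0, 0) rho theta -> rad + rho0 < rho ->
    is_multipole_sum lambda
      (trans_c lambda a rho0 theta0) (trans_d lambda a b rho0 theta0)
      rho theta (phi x).
Proof.
have [_ hsum] := hphi; split=> [l|x rho theta hx far].
  exact: translated_d_summable hlambda hrad hx0 hsum l.
by apply: (translated_multipole_sum hlambda hrad hx0 hsum hx far).
Qed.
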